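(* Let $n\ge1$ be an integer. For every algebraic polynomial $P$ with complex coefficients, of degree at most $n$, the following inequalities hold: $$\Vert P\Vert_W\le\sqrt{n+1}\,\Vert P\Vert_\infty,$$ the bound $\sqrt{n+1}$ being the best possible asymptotically as $n\to\infty$ (that is, if $C_n$ denotes the supremum of $\Vert P\Vert_W/\Vert P\Vert_\infty$ over all nonzero algebraic polynomials $P$ of degree at most $n$, then $C_n/\sqrt{n+1}\to1$ as $n\to\infty$); and $$\Vert P\Vert^{*}_{B^{0}_{\infty,1}}\le\left(\sum_{k=0}^{n-1}\frac{1}{2k+1}\right)\Vert P\Vert_\infty .$$
   Context: Let $\mathbb{D}$ be the open unit disk of $\mathbb{C}$. For a bounded analytic function $f$ on $\mathbb{D}$, $\Vert f\Vert_\infty=\sup_{z\in\mathbb{D}}|f(z)|$. The analytic Wiener algebra norm of $f=\sum_{k\ge0}a_kz^k$ is $\Vert f\Vert_W=\sum_{k\ge0}|a_k|$. The Besov semi-norm is $\Vert f\Vert^{*}_{B^{0}_{\infty,1}}=\int_0^1\Vert f'_r\Vert_\infty\,dr$, where $f'_r(z)=f'(rz)$, so that $\Vert f'_r\Vert_\infty=\sup_{z\in\mathbb{D}}|f'(rz)|$. *)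

(* Defs.v *)
From mathcomp Require Import all_boot all_order all_algebra.
From mathcomp Require Import complex.
From mathcomp Require Import all_classical all_reals all_analysis.

Set Implicit Arguments.
Unset Strict Implicit.
Unset Printing Implicit Defensive.

Import Order.TTheory GRing.Theory Num.Theory.
Import numFieldNormedType.Exports.

Local Open Scope classical_set_scope.
Local Open Scope ring_scope.
Local Open Scope complex_scope.

(* Norms take values in [\bar R], so that no convention is needed for
   functions of infinite norm.  The modulus used is the [R]-valued [normc]:
   the MathComp norm [`|z|] of [z : R[i]] is [(normc z)%:C], in [R[i]]. *)

Definition normc {R : realType} (z : R[i]) : R := ComplexField.Normc.normc z.

Definition unit_disk (R : realType) : set R[i] := [set z | normc z < 1].

Definition sup_norm (R : realType) (f : R[i] -> R[i]) : \bar R :=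
  ereal_sup [set (normc (f z))%:E | z in @unit_disk R].

(* The argument is the sequence of Taylor coefficients. *)
Definition wiener_norm (R : realType) (a : nat -> R[i]) : \bar R :=
  (\sum_(0 <= k <oo) (normc (a k))%:E)%E.

(* [R[i]^o] is the complex plane as a normed space over itself, so this is
   the derivative in the complex sense. *)
Definition complex_derive (R : realType) (f : R[i] -> R[i]) : R[i] -> R[i] :=
  @derive1 R[i] R[i]^o f.

Definition dilate (R : realType) (f : R[i] -> R[i]) (r : R) : R[i] -> R[i] :=
  fun z => f (r%:C * z).

Definition besov_seminorm (R : realType) (f : R[i] -> R[i]) : \bar R :=
  (\int[lebesgue_measure]_(r in `[0%R, 1%R]%classic)
     sup_norm (dilate (complex_derive f) r))%E.

Definition poly_sup_norm (R : realType) (P : {poly R[i]}) : \bar R :=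
  sup_norm (horner P).

Definition poly_wiener_norm (R : realType) (P : {poly R[i]}) : \bar R :=
  wiener_norm (fun k => P`_k).

Definition poly_besov_seminorm (R : realType) (P : {poly R[i]}) : \bar R :=
  besov_seminorm (horner P).

(* [size P <= n.+1] is "degree at most n".  For [P != 0] the sup norm is
   positive and finite, so the quotient in [\bar R] is the real one. *)
Definition best_wiener_constant (R : realType) (n : nat) : \bar R :=
  ereal_sup [set (poly_wiener_norm P / poly_sup_norm P)%E |
             P in [set P : {poly R[i]} | (size P <= n.+1)%N /\ P != 0]].

(* Main.v *)
(** Parseval over the [n+1]-st roots of unity and the Cauchy-Schwarz inequality
    give [||P||_W <= sqrt (n+1) ||P||_oo].

    For the Besov seminorm, [z P'(s z)] is the mean of [P(z w) w^-1 D(w^-1)^2]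
    over the unit circle, where [D w = \sum_(j < n) (s w)^j]; hence
    [||P'_s||_oo <= (\sum_(k < n) s^(2k)) ||P||_oo], and one integrates in [s].

    Sharpness comes from a windowed chirp
    [P z = \sum_k w_k omega^'C(k, 2) z^k] with [omega = e^(2 i pi / N)].  In the
    expansion of [|P z|^2] along diagonals the chirp only contributes, up to
    unimodular factors, the sums [\sum_l w_(l+h) w_l omega^(h l)].  Take
    [w = sin phi] on [0, N] for a slowly varying phase [phi] rising from [0] to
    [pi], and let [Q] be the chirp with window [v = cos phi] around the point [N],
    where [w] vanishes.  Then [|P|^2 <= |P|^2 + |Q|^2], and modulo [N] the two
    windows together satisfy
    [w_(l+h) w_l + v_(l+h) v_l = cos (phi_(l+h) - phi_l)], which is close to [1]
    for small [h], so that the sum over [l] nearly cancels; for large [h] two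
    summations by parts bound it by [O(N / h^2)].  Hence [|P|^2 <= (1 + o(1)) N],
    while most of the coefficients of [P] have modulus [1]. *)

Require Import Defs.
From mathcomp Require Import all_boot all_order all_algebra.
From mathcomp Require Import complex.
From mathcomp Require Import all_classical all_reals all_analysis.
From mathcomp Require Import ring lra zify.

Set Implicit Arguments.
Unset Strict Implicit.
Unset Printing Implicit Defensive.

Import Order.TTheory GRing.Theory Num.Theory.
Import numFieldNormedType.Exports.

Local Open Scope classical_set_scope.
Local Open Scope ring_scope.
Local Open Scope complex_scope.

(** * Parseval on the roots of unity *)

Section complex_modulus.
Variable R : realType.
Implicit Types (x y z : R[i]) (r : R).

Lemma normc_ge0 z : 0 <= normc z.
Proof. by case: z => a b; rewrite /normc /= sqrtr_ge0. Qed.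

Lemma normcM x y : normc (x * y) = normc x * normc y.
Proof. exact: ComplexField.Normc.normcM. Qed.

Lemma normcN x : normc (- x) = normc x.
Proof. exact: normcN. Qed.

Lemma normcD x y : normc (x + y) <= normc x + normc y.
Proof. exact: le_normcD. Qed.

Lemma normcV x : normc x^-1 = (normc x)^-1.
Proof. exact: ComplexField.Normc.normcV. Qed.

Lemma normc0 : normc (0 : R[i]) = 0.
Proof. exact: ComplexField.Normc.normc0. Qed.

Lemma normc1 : normc (1 : R[i]) = 1.
Proof. exact: ComplexField.Normc.normc1. Qed.

Lemma normc_eq0 x : (normc x == 0) = (x == 0).
Proof.
apply/eqP/eqP => [/ComplexField.Normc.eq0_normc//|->]; exact: normc0.
Qed.

Lemma normcX x n : normc (x ^+ n) = normc x ^+ n.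
Proof.
elim: n => [|n ih]; first by rewrite !expr0 normc1.
by rewrite !exprS normcM ih.
Qed.

Lemma normc_sum (I : Type) (s : seq I) (P : pred I) (F : I -> R[i]) :
  normc (\sum_(i <- s | P i) F i) <= \sum_(i <- s | P i) normc (F i).
Proof.
elim/big_rec2: _ => [|i a b _ ab]; first by rewrite normc0.
by apply: le_trans (normcD _ _) _; rewrite lerD2l.
Qed.

Lemma normc_real r : normc r%:C = `|r|.
Proof. by rewrite /normc /= expr0n /= addr0 sqrtr_sqr. Qed.

Lemma sqr_normc_conj z : ((normc z) ^+ 2)%:C = z * conjc z.
Proof.
case: z => a b; rewrite /normc /= sqr_sqrtr ?addr_ge0 ?sqr_ge0//.
by simpc; congr (_ +i* _); ring.
Qed.

Lemma ler_Re_normc z : complex.Re z <= normc z.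
Proof.
case: z => a b; rewrite /normc /=.
apply: le_trans (ler_norm a) _; rewrite -sqrtr_sqr.
by apply: ler_wsqrtr; rewrite lerDl sqr_ge0.
Qed.

Lemma unimodular_inv z : normc z = 1 -> z^-1 = conjc z.
Proof.
move=> z1; have z0 : z != 0 by rewrite -normc_eq0 z1 oner_eq0.
by apply: (mulfI z0); rewrite divff// -sqr_normc_conj z1 expr1n.
Qed.

End complex_modulus.

Section roots_of_unity.

Lemma prim_rootV (F : fieldType) (N : nat) (z : F) :
  N.-primitive_root z -> N.-primitive_root z^-1.
Proof.
case/andP=> N0 /forallP h; apply/andP; split=> //; apply/forallP => i.
have := h i; rewrite !unity_rootE exprVn.
by rewrite invr_eq1.
Qed.

Lemma sum_prim_root (F : fieldType) (N m : nat) (z : F) :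
  N.-primitive_root z -> ~~ (N %| m)%N -> \sum_(j < N) (z ^+ j) ^+ m = 0.
Proof.
move=> zN Nm; have zm : z ^+ m - 1 != 0.
  by rewrite subr_eq0 -(prim_order_dvd zN).
apply: (mulfI zm); rewrite mulr0.
transitivity ((z ^+ m - 1) * \sum_(j < N) (z ^+ m) ^+ j).
  by congr (_ * _); apply: eq_bigr => j _; rewrite -!exprM mulnC.
by rewrite -subrX1 -exprM mulnC exprM (prim_expr_order zN) expr1n subrr.
Qed.

(** Discrete Fourier inversion: the characters [j |-> z ^+ (j * k)] with [k < N] are orthogonal, and
    [size p <= N] rules out aliasing. *)
Lemma sum_horner_prim_root (F : fieldType) (N m : nat) (z : F) (p : {poly F}) :
  N.-primitive_root z -> (size p <= N)%N -> (m < N)%N ->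
  \sum_(j < N) p.[z ^+ j] * (z ^+ j) ^- m = N%:R * p`_m.
Proof.
move=> zN sp mN; have z0 : z != 0.
  apply/eqP => z0; have /eqP := prim_expr_order zN.
  by rewrite z0 expr0n gtn_eqF ?(prim_order_gt0 zN)// eq_sym oner_eq0.
transitivity (\sum_(j < N) \sum_(k < N) p`_k * ((z ^+ j) ^+ k * (z ^+ j) ^- m)).
  apply: eq_bigr => j _; rewrite (horner_coef_wide _ sp) mulr_suml.
  by apply: eq_bigr => k _; rewrite mulrA.
rewrite exchange_big /= (bigD1 (Ordinal mN))//= [X in _ + X]big1 ?addr0.
  rewrite -mulr_sumr mulrC; congr (_ * _).
  under eq_bigr => j _ do rewrite divff ?expf_neq0//.
  by rewrite sumr_const card_ord.
move=> k /negP km; rewrite -mulr_sumr.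
have {km}: nat_of_ord k != m by apply/eqP => E; apply: km; apply/eqP/val_inj.
rewrite neq_ltn => /orP[] km.
  (* The exponent [k - m] is negative here, so the sum is taken over the powers of the primitive
     root [z^-1]. *)
  rewrite (eq_bigr (fun j : 'I_N => (z^-1 ^+ j) ^+ (m - k))); last first.
    move=> j _; rewrite -{1}(subnK (ltnW km)) addnC exprD invfM mulrA divff ?mul1r ?expf_neq0//.
    by rewrite !exprVn.
  rewrite sum_prim_root ?mulr0//; first exact: prim_rootV.
  by rewrite gtnNdvd//; lia.
rewrite (eq_bigr (fun j : 'I_N => (z ^+ j) ^+ (k - m))); last first.
  by move=> j _; rewrite -{1}(subnK (ltnW km)) exprD mulfK// !expf_neq0.
rewrite sum_prim_root ?mulr0// gtnNdvd//; first lia.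
by have := ltn_ord k; lia.
Qed.

Lemma normc_prim_root (R : realType) (N : nat) (z : R[i]) :
  N.-primitive_root z -> normc z = 1.
Proof.
move=> zN; apply/eqP; rewrite -(@pexpr_eq1 _ _ N) ?normc_ge0//.
  by rewrite -normcX (prim_expr_order zN) normc1.
exact: prim_order_gt0 zN.
Qed.

Lemma conj_horner_unimodular (R : realType) (N : nat) (p : {poly R[i]}) (z : R[i]) :
  (size p <= N)%N -> normc z = 1 -> conjc p.[z] = \sum_(k < N) conjc p`_k * z ^- k.
Proof.
move=> sp z1; rewrite (horner_coef_wide _ sp) rmorph_sum/=.
apply: eq_bigr => k _; rewrite rmorphM rmorphXn/= -exprVn.
by rewrite unimodular_inv.
Qed.

Lemma parseval (R : realType) (N : nat) (z : R[i]) (p : {poly R[i]}) :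
  N.-primitive_root z -> (size p <= N)%N ->
  \sum_(j < N) normc p.[z ^+ j] ^+ 2 = N%:R * \sum_(k < N) normc p`_k ^+ 2.
Proof.
move=> zN sp; apply: complexI; rewrite rmorphM !rmorph_sum rmorph_nat /=.
under eq_bigr => j _.
  rewrite sqr_normc_conj (conj_horner_unimodular sp); last first.
    by rewrite normcX (normc_prim_root zN) expr1n.
  rewrite mulr_sumr.
  under eq_bigr => k _ do rewrite mulrCA.
  over.
rewrite exchange_big /= mulr_sumr; apply: eq_bigr => k _.
rewrite -mulr_sumr sum_horner_prim_root//.
by rewrite mulrCA sqr_normc_conj (mulrC (p`_k)).
Qed.

End roots_of_unity.

(** * Bounds on coefficients and on the derivative from values on the circle *)

Lemma sqr_sum_le (R : realDomainType) (N : nat) (x : 'I_N -> R) :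
  (\sum_(k < N) x k) ^+ 2 <= N%:R * \sum_(k < N) x k ^+ 2.
Proof.
rewrite -(ler_pM2l (ltr0Sn R 1)) expr2 mulr_suml.
under eq_bigr => i _ do rewrite mulr_sumr.
(* Cauchy-Schwarz against a constant vector, in the form of [2 x_i x_j <= x_i^2 + x_j^2] summed over
   all pairs. *)
have -> : 2 * (N%:R * \sum_(k < N) x k ^+ 2) =
   \sum_(i < N) \sum_(j < N) (x i ^+ 2 + x j ^+ 2).
  under [RHS]eq_bigr => i _ do rewrite big_split /= sumr_const card_ord.
  rewrite big_split /= sumr_const card_ord sumrMnl -mulr_natl; ring.
rewrite mulr_sumr; apply: ler_sum => i _; rewrite mulr_sumr.
apply: ler_sum => j _; have := sqr_ge0 (x i - x j); nra.
Qed.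

Lemma sum_normc_coef_le (R : realType) (N : nat) (z : R[i]) (p : {poly R[i]}) (M : R) :
  N.-primitive_root z -> (size p <= N)%N ->
  (forall x, normc x = 1 -> normc p.[x] <= M) ->
  \sum_(k < N) normc p`_k <= Num.sqrt N%:R * M.
Proof.
move=> zN sp pM; have N0 : 0 < N%:R :> R by rewrite ltr0n (prim_order_gt0 zN).
have M0 : 0 <= M by apply: le_trans (pM 1 (normc1 _)); exact: normc_ge0.
have S0 : 0 <= \sum_(k < N) normc p`_k by apply: sumr_ge0 => *; exact: normc_ge0.
rewrite -(@ler_pXn2r _ 2) ?nnegrE ?mulr_ge0 ?sqrtr_ge0//.
apply: (le_trans (sqr_sum_le (fun k : 'I_N => normc p`_k))).
rewrite exprMn (sqr_sqrtr (ltW N0)) -(parseval zN sp).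
have -> : N%:R * M ^+ 2 = \sum_(j < N) M ^+ 2 by rewrite sumr_const card_ord mulr_natl.
apply: ler_sum => j _; rewrite ler_pXn2r ?nnegrE ?normc_ge0//.
by apply: pM; rewrite normcX (normc_prim_root zN) expr1n.
Qed.

(* [(\sum_(j < n) (s w)^j)^2] has Taylor coefficients [(m + 1) s^m] for
   [m < n], so convolving it with [P] on the circle yields [P'(s .)]; its
   [L^1] norm is the squared [L^2] norm of [\sum_(j < n) (s w)^j]. *)
Lemma normc_deriv_le (R : realType) (n : nat) (z u : R[i]) (p : {poly R[i]}) (M : R) :
  (n.*2).-primitive_root z -> (size p <= n.+1)%N ->
  (forall x, normc x = 1 -> normc p.[x] <= M) ->
  normc p^`().[u] <= (\sum_(k < n) normc u ^+ k.*2) * M.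
Proof.
move=> zN sp pM; set s := normc u.
have n0 : (0 < n)%N by have := prim_order_gt0 zN; lia.
have s0 : 0 <= s := normc_ge0 u.
have [x x1 ux] : exists2 x, normc x = 1 & u = s%:C * x.
  have [u0|u0] := eqVneq u 0.
    by exists 1; rewrite ?normc1// /s u0 normc0 mul0r.
  have sn0 : s != 0 by rewrite normc_eq0.
  have sC0 : s%:C != 0 by rewrite -normc_eq0 normc_real normr_eq0.
  exists (u / s%:C); last by rewrite mulrC divfK.
  by rewrite normcM normcV normc_real ger0_norm// divff.
have x0 : x != 0 by rewrite -normc_eq0 x1 oner_eq0.
pose D : {poly R[i]} := \poly_(j < n) (s ^+ j)%:C.
pose px := p \Po (x *: 'X).
have pxE k : px`_k = p`_k * x ^+ k.
  rewrite /px comp_polyE.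
  rewrite coef_sum.
  have [kp|kp] := ltnP k (size p); last first.
    rewrite nth_default// mul0r big1// => i _.
    rewrite exprZn coefZ coefZ coefXn; case: eqP => [E|_]; last by rewrite !mulr0.
    by have := ltn_ord i; rewrite -E ltnNge kp.
  rewrite (bigD1 (Ordinal kp))//= big1 ?addr0.
    by rewrite exprZn !coefZ coefXn eqxx mulr1.
  move=> i ik; rewrite exprZn !coefZ coefXn; case: eqP => [E|_]; last by rewrite !mulr0.
  by move: ik; rewrite -val_eqE /= E eqxx.
have spx : (size px <= n.*2)%N.
  apply: leq_trans (_ : n.+1 <= _)%N; last lia.
  by apply/leq_sizeP => j /(leq_trans sp) h; rewrite pxE nth_default ?mul0r.
have sD : (size D <= n)%N by exact: size_poly.
(* The shift by [w^-1] pairs the coefficient [m] of [D * D] with the coefficient [m + 1 <= 2n - 1]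
   of [px], so [2n] nodes suffice for exact inversion. *)
have sD2 : (size (D * D)%R <= n.*2.-1)%N.
  by apply: leq_trans (size_polyMleq _ _) _; move: sD; lia.
have coefD m : (m < n)%N -> (D * D)`_m = (m.+1)%:R * (s ^+ m)%:C.
  move=> mn; rewrite coefM (eq_bigr (fun=> (s ^+ m)%:C)).
    by rewrite sumr_const card_ord mulr_natl.
  move=> j _; rewrite !coef_poly.
  have -> : (j < n)%N by have := ltn_ord j; lia.
  have -> : (m - j < n)%N by lia.
  rewrite -rmorphM -exprD; congr (_ ^+ _)%:C; have := ltn_ord j; lia.
have key : \sum_(j < n.*2) p.[x * z ^+ j] * ((z ^+ j)^-1 * D.[(z ^+ j)^-1] ^+ 2)
   = (n.*2)%:R * (x * p^`().[u]).
  transitivity (\sum_(j < n.*2) \sum_(m < n.*2.-1)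
     (D * D)`_m * (px.[z ^+ j] * (z ^+ j) ^- m.+1)).
    apply: eq_bigr => j _; rewrite expr2 -hornerM (horner_coef_wide _ sD2).
    rewrite !mulr_sumr; apply: eq_bigr => m _.
    rewrite /px horner_comp hornerZ hornerX.
    set y := z ^+ j; rewrite -(exprVn y m.+1) exprS; ring.
  rewrite exchange_big /=.
  under eq_bigr => m _.
    rewrite -mulr_sumr sum_horner_prim_root//; last by have := ltn_ord m; lia.
    rewrite pxE mulrCA; over.
  rewrite -mulr_sumr; congr (_ * _).
  have sd : (size p^`() <= n)%N.
    by apply: leq_trans (size_poly _ _) _; move: sp; lia.
  rewrite (horner_coef_wide _ sd) mulr_sumr.
  rewrite (big_ord_widen_cond n.*2.-1 xpredT (fun m =>
    x * (p^`()`_m * u ^+ m))); last lia.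
  rewrite [RHS]big_mkcond /=; apply: eq_bigr => m _.
  case: ifPn => mn; last first.
    have -> : p`_m.+1 = 0 by rewrite nth_default//; apply: (leq_trans sp); rewrite ltnS leqNgt.
    by rewrite ?(mul0r, mulr0).
  rewrite coefD// coef_deriv ux exprMn rmorphXn/= exprS -mulr_natl; ring.
have N0 : 0 < (n.*2)%:R :> R by rewrite ltr0n; lia.
have : normc ((n.*2)%:R * (x * p^`().[u])) <=
   \sum_(j < n.*2) M * normc D.[(z^-1) ^+ j] ^+ 2.
  rewrite -key; apply: le_trans (normc_sum _ _ _) _; apply: ler_sum => j _.
  have zj : normc (z ^+ j) = 1 by rewrite normcX (normc_prim_root zN) expr1n.
  rewrite normcM normcM normcV zj invr1 mul1r normcX exprVn.
  by apply: ler_wpM2r; [exact: exprn_ge0 (normc_ge0 _)|apply: pM; rewrite normcM x1 zj mulr1].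
(* The kernel has modulus [|D|^2], whose mean over the nodes is the sum of the squared coefficients
   of [D]. *)
rewrite -mulr_sumr (parseval (prim_rootV zN)); last lia.
rewrite normcM normcM x1 mul1r.
have -> : normc ((n.*2)%:R : R[i]) = (n.*2)%:R.
  have -> : ((n.*2)%:R : R[i]) = (n.*2)%:R%:C by rewrite rmorph_nat.
  by rewrite normc_real normr_nat.
rewrite mulrCA ler_pM2l// mulrC; move/le_trans; apply.
rewrite ler_wpM2r//; first by apply: le_trans (pM 1 (normc1 _)); exact: normc_ge0.
rewrite [leRHS](big_ord_widen_cond n.*2 xpredT (fun m => s ^+ m.*2)); last lia.
rewrite [leRHS]big_mkcond /=; apply: ler_sum => k _.
rewrite coef_poly; case: ifPn => kn; last by rewrite normc0 expr0n.
by rewrite normc_real ger0_norm ?exprn_ge0// -exprM muln2.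
Qed.

(** * Trigonometric estimates *)

Section trigonometric_inequalities.
Variable R : realType.
Implicit Types a b d t x y : R.

Lemma normr_sinB x y : `|sin x - sin y| <= `|x - y|.
Proof.
wlog xy : x y / y <= x.
  move=> h; case: (leP y x) => [/h//|/ltW/h].
  by rewrite distrC [leRHS]distrC.
have [c _ ->] : exists2 c, c \in `[y, x] & sin x - sin y = cos c * (x - y).
  apply: (@MVT_segment _ sin cos) => //.
  by apply: continuous_subspaceT => c; exact: continuous_sin.
by rewrite normrM ler_piMl// cos_max.
Qed.

Lemma normr_sin_le x : `|sin x| <= `|x|.
Proof. by have := normr_sinB x 0; rewrite sin0 !subr0. Qed.

Lemma cos_double x : cos x = 1 - 2 * sin (x / 2) ^+ 2.
Proof.
have -> : cos x = cos ((x / 2) *+ 2) by congr cos; lra.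
rewrite cos_mulr2n cos2sin2; lra.
Qed.

Lemma oneBcos_le x : 1 - cos x <= x ^+ 2 / 2.
Proof.
rewrite cos_double.
have : sin (x / 2) ^+ 2 <= (x / 2) ^+ 2.
  rewrite -(real_normK (num_real (sin _))) -(real_normK (num_real (x / 2))).
  by rewrite ler_pXn2r ?nnegrE ?normr_ge0 ?normr_sin_le.
nra.
Qed.

(** With [y = x / 2], the mean value theorem gives [sin y >= y cos y], so [sin x >= 2 y cos^2 y],
    and [cos^2 y >= 1 / 2] because [cos x >= 0]. *)
Lemma sin_ge_half x : 0 <= x <= pi / 2 -> x / 2 <= sin x.
Proof.
move=> /andP[x0 xpi]; pose y := x / 2.
have p0 := pi_gt0 R.
have y0 : 0 <= y by rewrite /y; lra.
have [c cy] : exists2 c : R, c \in `[0, y] & sin y - sin 0 = cos c * (y - 0).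
  apply: (@MVT_segment _ sin cos) => //.
  by apply: continuous_subspaceT => c; exact: continuous_sin.
rewrite sin0 !subr0 => sy.
have sx : sin x = 2 * cos y * sin y.
  have -> : sin x = sin (y *+ 2) by congr sin; rewrite /y; lra.
  by rewrite sin_mulr2n; lra.
have cy2 : 1 / 2 <= cos y ^+ 2.
  have : 0 <= cos x by apply: cos_ge0_pihalf; lra.
  have -> : cos x = cos (y *+ 2) by congr cos; rewrite /y; lra.
  by rewrite cos_mulr2n; lra.
have cy0 : 0 <= cos y by apply: cos_ge0_pihalf; rewrite /y; lra.
have cc : cos y <= cos c.
  move: cy; rewrite in_itv /= => /andP[c0 cy].
  have cpi : c <= pi by move: cy; rewrite /y; lra.
  have ypi : y <= pi by rewrite /y; lra.
  by rewrite leNgt ltr_cos ?in_itv/= -?leNgt ?c0 ?cpi ?y0 ?ypi.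
rewrite sx sy.
have : 0 <= cos y * y * (cos c - cos y) by rewrite !mulr_ge0// subr_ge0.
have : 0 <= y * (cos y ^+ 2 - 1 / 2) by rewrite mulr_ge0// subr_ge0.
have -> : x = 2 * y by rewrite /y; lra.
nra.
Qed.

Lemma sin_diff2_le (a b y0 y1 y2 : R) :
  `|y1 - y0| <= a -> `|y2 - y1| <= a -> `|y2 - 2 * y1 + y0| <= b ->
  `|sin y2 - 2 * sin y1 + sin y0| <= b + a ^+ 2.
Proof.
(* Around the midpoint, [sin y2 + sin y0 = 2 sin m cos d]. Replacing [m] by [y1] costs at most [b],
   and replacing [cos d] by [1] costs at most [d^2 <= a^2]. *)
move=> h0 h1 hb; pose m := (y0 + y2) / 2; pose d := (y2 - y0) / 2.
have -> : y2 = m + d by rewrite /m /d; lra.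
have -> : y0 = m - d by rewrite /m /d; lra.
rewrite sinD sinB.
have -> : sin m * cos d + cos m * sin d - 2 * sin y1 +
   (sin m * cos d - cos m * sin d) =
   2 * (sin m - sin y1) - 2 * sin m * (1 - cos d) by ring.
apply: le_trans (ler_normB _ _) _; apply: lerD.
  rewrite normrM ger0_norm//.
  have := normr_sinB m y1.
  have : `|m - y1| = `|y2 - 2 * y1 + y0| / 2.
    have -> : m - y1 = (y2 - 2 * y1 + y0) / 2 by rewrite /m; lra.
    by rewrite normrM [`|2^-1|]ger0_norm// invr_ge0.
  lra.
rewrite !normrM [`|2|]ger0_norm// [`|1 - _|]ger0_norm ?subr_ge0 ?cos_le1//.
have dl : `|d| <= a by rewrite /d ler_norml; move: h0 h1; rewrite !ler_norml; lra.
have d2 : d ^+ 2 <= a ^+ 2.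
  rewrite -(real_normK (num_real d)) ler_pXn2r ?nnegrE ?normr_ge0//.
  exact: le_trans (normr_ge0 _) dl.
have := oneBcos_le d; have := cos_le1 d; have := sin_max m.
have := normr_ge0 (sin m); nra.
Qed.

Lemma cos_diff2_le (a b y0 y1 y2 : R) :
  `|y1 - y0| <= a -> `|y2 - y1| <= a -> `|y2 - 2 * y1 + y0| <= b ->
  `|cos y2 - 2 * cos y1 + cos y0| <= b + a ^+ 2.
Proof.
move=> h0 h1 hb; rewrite -!sinDpihalf; apply: sin_diff2_le.
- by move: h0; congr (`|_| <= _); ring.
- by move: h1; congr (`|_| <= _); ring.
- by move: hb; congr (`|_| <= _); ring.
Qed.

Lemma normr_cosB x y : `|cos x - cos y| <= `|x - y|.
Proof.
rewrite -!sinDpihalf; apply: le_trans (normr_sinB _ _) _.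
by rewrite opprD addrACA subrr addr0.
Qed.

End trigonometric_inequalities.

(** * The complex exponential and its chords *)

Section complex_exponential.
Variable R : realType.
Implicit Types t u : R.

Definition expi t : R[i] := cos t +i* sin t.

Lemma expi0 : expi 0 = 1.
Proof. by rewrite /expi cos0 sin0. Qed.

Lemma expiD t u : expi (t + u) = expi t * expi u.
Proof. by rewrite /expi cosD sinD; simpc; congr (_ +i* _); ring. Qed.

Lemma expiX t n : expi t ^+ n = expi (n%:R * t).
Proof.
elim: n => [|n ih]; first by rewrite expr0 mul0r expi0.
by rewrite exprS ih -expiD -natr1; congr expi; ring.
Qed.

Lemma normc_expi t : normc (expi t) = 1.
Proof. by rewrite /normc /= cos2Dsin2 sqrtr1. Qed.

Lemma normc_oneBexpi t : normc (1 - expi (2 * t)) = 2 * `|sin t|.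
Proof.
rewrite /expi /normc /=.
have -> : (1 - cos (2 * t)) ^+ 2 + (0 - sin (2 * t)) ^+ 2 = (2 * sin t) ^+ 2.
  have := cos2Dsin2 (2 * t); rewrite (cos_double (2 * t)).
  have -> : 2 * t / 2 = t by lra.
  nra.
by rewrite sqrtr_sqr normrM [`|2|]ger0_norm.
Qed.

Lemma expi2pi : expi (2 * pi) = 1.
Proof.
by rewrite /expi (_ : 2 * pi = pi *+ 2) ?cos2pi ?sin2pi// mulr_natl.
Qed.

(** The chord has length [2 |sin (pi h / N)|]; reflecting the angle into [[0, pi / 2]] makes
    [sin_ge_half] applicable. *)
Lemma normc_oneBexpi_ge (N h : nat) : (h < N)%N ->
  pi * Num.min h%:R (N - h)%:R / N%:R
    <= normc (1 - expi (2 * pi / N%:R) ^+ h).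
Proof.
move=> hN; have N0 : 0 < N%:R :> R by rewrite ltr0n; lia.
have p0 := pi_gt0 R.
rewrite expiX.
pose al : R := pi * h%:R / N%:R.
have -> : h%:R * (2 * pi / N%:R) = 2 * al by rewrite /al; ring.
rewrite normc_oneBexpi.
have al0 : 0 <= al by apply: divr_ge0; [apply: mulr_ge0; [exact: ltW|exact: ler0n]|exact: ltW].
have alpi : pi - al = pi * (N - h)%:R / N%:R.
  by rewrite (natrB _ (ltnW hN)) /al; field; rewrite gt_eqF.
have al1 : 0 <= pi - al.
  rewrite alpi; apply: divr_ge0; last exact: ltW.
  by apply: mulr_ge0; [exact: ltW|exact: ler0n].
rewrite minr_pMr ?(ltW p0)// minr_pMl ?invr_ge0 ?(ltW N0)//.
rewrite -/al -alpi.
case: (leP al (pi / 2)) => ha.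
  have := @sin_ge_half R al; have := ler_norm (sin al).
  by rewrite ge_min; lra.
have := @sin_ge_half R (pi - al); have := ler_norm (sin al).
rewrite sinB sinpi cospi ge_min; lra.
Qed.

Lemma expi_prim_root (N : nat) : (0 < N)%N ->
  N.-primitive_root (expi (2 * pi / N%:R)).
Proof.
move=> N0; have N0' : N%:R != 0 :> R by rewrite pnatr_eq0; lia.
apply/andP; split=> //; apply/forallP => i; rewrite unity_rootE.
have iN := ltn_ord i; apply/eqP.
have [->|iN'] := eqVneq i.+1 N.
  by rewrite expiX mulrCA divff// mulr1 expi2pi eqxx.
apply/negbTE; rewrite eq_sym -subr_eq0 -normc_eq0 gt_eqF//.
apply: lt_le_trans (normc_oneBexpi_ge _); last lia.
rewrite divr_gt0 ?mulr_gt0 ?pi_gt0 ?ltr0n// lt_min !ltr0n; lia.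
Qed.

End complex_exponential.

(** * Chirp sums *)

Section summation.

Lemma double_sum_diagonals (V : zmodType) (F : nat -> nat -> V) (K : nat) :
  \sum_(0 <= k < K) \sum_(0 <= l < K) F k l = \sum_(0 <= k < K) F k k +
    \sum_(1 <= h < K) \sum_(0 <= l < K - h) (F (l + h)%N l + F l (l + h)%N).
Proof.
elim: K => [|K ih].
  by rewrite !big_geq// addr0.
(* Enlarging the square by one lengthens each diagonal by its entry with [l = K - h]; together these
   entries are the new row and column. *)
have -> : \sum_(1 <= h < K.+1) \sum_(0 <= l < K.+1 - h)
      (F (l + h)%N l + F l (l + h)%N) =
   \sum_(1 <= h < K) \sum_(0 <= l < K - h) (F (l + h)%N l + F l (l + h)%N) +
   \sum_(0 <= l < K) (F K l + F l K).
  transitivity (\sum_(1 <= h < K.+1) (\sum_(0 <= l < K - h)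
      (F (l + h)%N l + F l (l + h)%N) + (F K (K - h)%N + F (K - h)%N K))).
    apply: eq_big_nat => h /andP[h1 hK].
    rewrite subSn; last lia.
    by rewrite big_nat_recr//= subnK; last lia.
  rewrite big_split /=; congr (_ + _).
    case: K {ih} => [|K]; first by rewrite !big_geq.
    by rewrite big_nat_recr//= subnn [X in _ + X]big_geq// addr0.
  rewrite [RHS]big_nat_rev /= add0n big_add1 /=.
  by [].
rewrite [LHS]big_nat_recr//=.
under eq_bigr => k _ do rewrite big_nat_recr//=.
rewrite big_split /= ih [X in _ + X]big_nat_recr//= [in RHS]big_nat_recr//=.
rewrite [\sum_(0 <= l < K) (F K l + _)]big_split /=.
by rewrite -!addrA; congr (_ + _); rewrite [RHS]addrCA; congr (_ + _);
  rewrite addrCA [RHS]addrCA; congr (_ + _); rewrite addrC.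
Qed.

Lemma sqr_normc_sum (R : realType) (u : nat -> R[i]) (K : nat) :
  normc (\sum_(0 <= k < K) u k) ^+ 2 = \sum_(0 <= k < K) normc (u k) ^+ 2 +
    \sum_(1 <= h < K)
      2 * complex.Re (\sum_(0 <= l < K - h) u (l + h)%N * conjc (u l)).
Proof.
apply: complexI; rewrite rmorphD /= sqr_normc_conj !rmorph_sum /=.
transitivity (\sum_(0 <= k < K) \sum_(0 <= l < K) u k * conjc (u l)).
  by rewrite mulr_suml; apply: eq_bigr => k _; rewrite mulr_sumr.
rewrite (double_sum_diagonals (fun k l => u k * conjc (u l))).
congr (_ + _); first by apply: eq_bigr => k _; rewrite sqr_normc_conj.
apply: eq_bigr => h _; rewrite rmorphM rmorph_nat -addcJ rmorph_sum /= big_split /=.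
by congr (_ + _); apply: eq_bigr => l _; rewrite rmorphM /= conjcK mulrC.
Qed.

(** Two summations by parts; the vanishing of [g] at [0], [1] and from [L] on removes the boundary
    terms. *)
Lemma sum_second_difference (A : comRingType) (g : nat -> A) (x : A) (L : nat) :
  g 0%N = 0 -> g 1%N = 0 -> (forall l, (L <= l)%N -> g l = 0) ->
  (1 - x) ^+ 2 * (\sum_(0 <= l < L) g l * x ^+ l) =
    \sum_(0 <= l < L) (g l.+2 - 2 * g l.+1 + g l) * x ^+ l.+2.
Proof.
move=> g0 g1 gL.
have shift (f : nat -> A) : f 0%N = 0 -> f L = 0 ->
    \sum_(0 <= l < L) f l.+1 * x ^+ l.+1 = \sum_(0 <= l < L) f l * x ^+ l.
  move=> f0 fL; have : \sum_(0 <= l < L.+1) f l * x ^+ l =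
      \sum_(0 <= l < L) f l.+1 * x ^+ l.+1.
    by rewrite big_nat_recl//= f0 mul0r add0r.
  by rewrite big_nat_recr//= fL mul0r addr0 => ->.
have E1 := shift g g0 (gL L (leqnn _)).
have E2 : \sum_(0 <= l < L) g l.+2 * x ^+ l.+2 =
    x * \sum_(0 <= l < L) g l.+1 * x ^+ l.
  rewrite -(shift (fun l => g l.+1))//; last by apply: gL; lia.
  by rewrite mulr_sumr; apply: eq_bigr => l _; rewrite (exprS x l.+1); ring.
have E3 : x * \sum_(0 <= l < L) g l.+1 * x ^+ l = \sum_(0 <= l < L) g l * x ^+ l.
  by rewrite -E1 mulr_sumr; apply: eq_bigr => l _; rewrite exprS; ring.
rewrite E3 in E2.
transitivity (\sum_(0 <= l < L) g l.+2 * x ^+ l.+2 -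
   2 * x * (\sum_(0 <= l < L) g l.+1 * x ^+ l.+1) +
   x ^+ 2 * (\sum_(0 <= l < L) g l * x ^+ l)).
  by rewrite E1 E2; ring.
rewrite !mulr_sumr -sumrB -big_split /=; apply: eq_bigr => l _.
rewrite !exprS; ring.
Qed.

Lemma normc_sum_second_difference (R : realType) (g : nat -> R) (x : R[i])
    (L : nat) (B : R) :
  g 0%N = 0 -> g 1%N = 0 -> (forall l, (L <= l)%N -> g l = 0) ->
  normc x = 1 -> (forall l, `|g l.+2 - 2 * g l.+1 + g l| <= B) ->
  normc (1 - x) ^+ 2 * normc (\sum_(0 <= l < L) (g l)%:C * x ^+ l) <= L%:R * B.
Proof.
move=> g0 g1 gL x1 gB; rewrite -normcX -normcM.
rewrite (@sum_second_difference _ (fun l => (g l)%:C)) ?g0 ?g1//; last first.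
  by move=> l /gL ->.
apply: le_trans (normc_sum _ _ _) _.
have -> : L%:R * B = \sum_(0 <= l < L) B.
  by rewrite sumr_const_nat subn0 mulr_natl.
apply: ler_sum => l _; rewrite normcM normcX x1 expr1n mulr1.
have -> : (g l.+2)%:C - 2 * (g l.+1)%:C + (g l)%:C =
    (g l.+2 - 2 * g l.+1 + g l)%:C.
  by rewrite rmorphD rmorphB rmorphM rmorph_nat.
by rewrite normc_real.
Qed.

Lemma sum_inv_sqr_le (R : realFieldType) (H N : nat) : (0 < H)%N ->
  \sum_(H.+1 <= h < N) (h%:R ^+ 2)^-1 <= H%:R^-1 :> R.
Proof.
move=> H0; have [NH|HN] := leqP N H.+1.
  by rewrite big_geq// invr_ge0.
(* Telescoping [1 / h^2 <= 1 / (h - 1) - 1 / h]; keeping the end term lets the induction go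
   through. *)
have : \sum_(H.+1 <= h < N) (h%:R ^+ 2)^-1 <= H%:R^-1 - N.-1%:R^-1 :> R.
  have {}HN := ltnW HN.
  elim: N HN => // N ih; rewrite ltnS leq_eqVlt => /orP[/eqP<-|/[dup] {}HN /ih {}ih].
    by rewrite big_geq// subrr.
  rewrite big_nat_recr//=.
  apply: le_trans (lerD ih (lexx _)) _; case: N HN {ih} => // N HN.
  rewrite -pred_Sn -addrA lerD2l.
  have n0 : 0 < N%:R :> R by rewrite ltr0n; lia.
  rewrite -(natr1 N).
  have -> : - N%:R^-1 + ((N%:R + 1) ^+ 2)^-1 =
     - (N%:R + 1)^-1 - (N%:R * (N%:R + 1) ^+ 2)^-1 :> R.
    by field; lra.
  rewrite gerBl invr_ge0 mulr_ge0 ?exprn_ge0//; lra.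
by move/le_trans; apply; rewrite gerBl invr_ge0.
Qed.

End summation.

Section chirp.
Variables (R : realType).

(** Along the diagonal [h] the quadratic phase becomes linear in [l], up to a unimodular factor that
    depends on [h] only. This factor is common to both windows, so their correlations add up before
    moduli are taken. *)
Lemma normc_chirp_le (w v : nat -> R) (x z : R[i]) (K : nat) :
  normc x = 1 -> normc z = 1 ->
  normc (\sum_(0 <= k < K) (w k)%:C * x ^+ 'C(k, 2) * z ^+ k) ^+ 2 <=
  \sum_(0 <= k < K) (w k ^+ 2 + v k ^+ 2) +
  2 * \sum_(1 <= h < K) normc (\sum_(0 <= l < K - h)
     (w (l + h)%N * w l + v (l + h)%N * v l)%:C * (x ^+ h) ^+ l).
Proof.
move=> x1 z1.
pose u (f : nat -> R) k := (f k)%:C * x ^+ 'C(k, 2) * z ^+ k.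
have uu f h l : u f (l + h)%N * conjc (u f l) =
   x ^+ 'C(h, 2) * z ^+ h * ((f (l + h)%N * f l)%:C * (x ^+ h) ^+ l).
  have C2 : 'C(l + h, 2) = ('C(l, 2) + 'C(h, 2) + h * l)%N.
    elim: h => [|h ih]; first by rewrite addn0 bin0n mul0n !addn0.
    by rewrite addnS !binS !bin1 ih; lia.
  have xx n : x ^+ n * conjc (x ^+ n) = 1.
    by rewrite -sqr_normc_conj normcX x1 !expr1n.
  have zz n : z ^+ n * conjc (z ^+ n) = 1.
    by rewrite -sqr_normc_conj normcX z1 !expr1n.
  rewrite /u !(rmorphM (conjc (R := R))) /= oppr0 complexr0 C2 !exprD exprM.
  transitivity (x ^+ 'C(h, 2) * z ^+ h * ((f (l + h)%N)%:C * (f l)%:C * (x ^+ h) ^+ l) *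
     (x ^+ 'C(l, 2) * conjc (x ^+ 'C(l, 2))) * (z ^+ l * conjc (z ^+ l))).
    ring.
  by rewrite xx zz !mulr1 rmorphM.
have un f k : normc (u f k) ^+ 2 = f k ^+ 2.
  rewrite /u !normcM !normcX x1 z1 !expr1n !mulr1 normc_real.
  by rewrite real_normK ?num_real.
have Ew := sqr_normc_sum (u w) K; have Ev := sqr_normc_sum (u v) K.
have v0 := exprn_ge0 2 (normc_ge0 (\sum_(0 <= k < K) u v k)).
have -> : normc (\sum_(0 <= k < K) (w k)%:C * x ^+ 'C(k, 2) * z ^+ k) =
   normc (\sum_(0 <= k < K) u w k) by [].
apply: le_trans (_ : normc (\sum_(0 <= k < K) u w k) ^+ 2 +
  normc (\sum_(0 <= k < K) u v k) ^+ 2 <= _); first by rewrite lerDl.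
rewrite Ew Ev addrACA -!big_split /= mulr_sumr; apply: lerD.
  by apply: ler_sum => k _; rewrite !un.
apply: ler_sum => h _; rewrite -mulrDr ler_pM2l//.
rewrite -raddfD /= -big_split /=.
apply: le_trans (ler_Re_normc _) _.
under eq_bigr => l _ do rewrite !uu -mulrDr -mulrDl -rmorphD /=.
by rewrite -mulr_sumr !normcM !normcX x1 z1 !expr1n !mul1r.
Qed.

End chirp.

(** * Phase and windows *)

Section phase.

(* Triangular increments make the first and second differences of the
   rescaled ramp [O(1 / M)] and [O(1 / M ^ 2)].  Below, truncated subtraction
   keeps a shifted ramp at [0] before its starting point. *)
Definition ramp (M k : nat) : nat := (\sum_(0 <= j < k) minn j (2 * M - j))%N.

Lemma rampS M k : ramp M k.+1 = (ramp M k + minn k (2 * M - k))%N.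
Proof. by rewrite /ramp big_nat_recr. Qed.

Lemma ramp0 M : ramp M 0 = 0%N.
Proof. by rewrite /ramp big_geq. Qed.

Lemma ramp_low M k : (k <= M)%N -> (2 * ramp M k + k = k * k)%N.
Proof.
elim: k => [|k ih] kM; first by rewrite ramp0.
rewrite rampS (minn_idPl _); last lia.
have := ih (ltnW kM); nia.
Qed.

(** Truncated [M - k] makes this identity cover the descending half of the triangle and the constant
    stretch after it. *)
Lemma ramp_high M k :
  (2 * ramp M (M + k) + (M - k) * (M - k).+1 = 2 * (M * M))%N.
Proof.
elim: k => [|k ih].
  by rewrite addn0 subn0; have := ramp_low (leqnn M); nia.
rewrite addnS rampS (minn_idPr _); last lia.
have [Mk|kM] := leqP M k.
  move: ih; have -> : (M - k = 0)%N by lia.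
  have -> : (M - k.+1 = 0)%N by lia.
  have -> : (2 * M - (M + k) = 0)%N by lia.
  by rewrite addn0.
have [d Md] : exists d, M = (k + d.+1)%N by exists (M - k.+1)%N; lia.
move: ih; have -> : (M - k = d.+1)%N by lia.
have -> : (M - k.+1 = d)%N by lia.
have -> : (2 * M - (M + k) = d.+1)%N by lia.
nia.
Qed.

Lemma ramp_max M k : (2 * M <= k)%N -> ramp M k = (M * M)%N.
Proof.
move=> Mk; have := ramp_high M (k - M).
have -> : (M + (k - M) = k)%N by lia.
have -> : (M - (k - M) = 0)%N by lia.
lia.
Qed.

(** Three rises of height [M^2], over [[M, 3M]], [[N - 3M, N - M]] and [[N + M, N + 3M]]. The third
    is the first one translated by [N], which gives the phase its quasi-periodicity. *)
Definition phase_steps (N M k : nat) : nat :=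
  (ramp M (k - M) + ramp M (k - (N - 3 * M)) + ramp M (k - (N + M)))%N.

Let ramp_subS M c k :
  ramp M (k.+1 - c) = (ramp M (k - c) + minn (k - c) (2 * M - (k - c)))%N.
Proof.
have [ck|kc] := leqP c k; first by rewrite subSn// rampS.
have -> : (k.+1 - c = 0)%N by lia.
have -> : (k - c = 0)%N by lia.
by rewrite min0n addn0.
Qed.

Lemma phase_stepsS N M k :
  phase_steps N M k.+1 = (phase_steps N M k + (minn (k - M) (2 * M - (k - M)) +
    minn (k - (N - 3 * M)) (2 * M - (k - (N - 3 * M))) +
    minn (k - (N + M)) (2 * M - (k - (N + M)))))%N.
Proof. by rewrite /phase_steps !ramp_subS; lia. Qed.

Section values.
Variables (N M : nat).
Hypothesis MN : (8 * M <= N)%N.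

Lemma phase_steps_start k : (k <= M)%N -> phase_steps N M k = 0%N.
Proof.
move=> kM; rewrite /phase_steps.
have -> : (k - M = 0)%N by lia.
have -> : (k - (N - 3 * M) = 0)%N by lia.
have -> : (k - (N + M) = 0)%N by lia.
by rewrite ramp0.
Qed.

Lemma phase_steps_plateau k : (3 * M <= k <= N - 3 * M)%N ->
  phase_steps N M k = (M * M)%N.
Proof.
move=> kM; rewrite /phase_steps (@ramp_max M (k - M)); last lia.
have -> : (k - (N - 3 * M) = 0)%N by lia.
have -> : (k - (N + M) = 0)%N by lia.
by rewrite ramp0 !addn0.
Qed.

Lemma phase_steps_middle k : (N - M <= k <= N + M)%N ->
  phase_steps N M k = (2 * (M * M))%N.
Proof.
move=> kM; rewrite /phase_steps (@ramp_max M (k - M)); last lia.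
rewrite (@ramp_max M (k - (N - 3 * M))); last lia.
have -> : (k - (N + M) = 0)%N by lia.
by rewrite ramp0; lia.
Qed.

Lemma phase_steps_end k : (N + 3 * M <= k)%N ->
  phase_steps N M k = (3 * (M * M))%N.
Proof.
by move=> kM; rewrite /phase_steps !ramp_max; lia.
Qed.

Lemma phase_steps_period k : (k <= N - 3 * M)%N ->
  phase_steps N M (k + N) = (phase_steps N M k + 2 * (M * M))%N.
Proof.
move=> kM; rewrite /phase_steps (@ramp_max M (k + N - M)); last lia.
rewrite (@ramp_max M (k + N - (N - 3 * M))); last lia.
have -> : (k + N - (N + M) = k - M)%N by lia.
have -> : (k - (N - 3 * M) = 0)%N by lia.
have -> : (k - (N + M) = 0)%N by lia.
rewrite ramp0; lia.
Qed.

End values.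

End phase.

(** * The two windows and their correlations *)

Section windows.
Variables (R : realType) (N M : nat).
Hypotheses (M2 : (2 <= M)%N) (MN : (8 * M <= N)%N).

Definition phase (k : nat) : R :=
  pi / 2 * (phase_steps N M k)%:R / M%:R ^+ 2.

Let M0 : 0 < M%:R :> R. Proof. by rewrite ltr0n; lia. Qed.
Let phaseE k (c : nat) : phase_steps N M k = (c * (M * M))%N ->
  phase k = c%:R * (pi / 2).
Proof.
by move=> E; rewrite /phase E !natrM; field; rewrite gt_eqF.
Qed.

Lemma phase_start k : (k <= M)%N -> phase k = 0.
Proof.
move=> kM; rewrite (@phaseE _ 0) ?mul0r//.
exact: phase_steps_start.
Qed.

Lemma phase_plateau k : (3 * M <= k <= N - 3 * M)%N -> phase k = pi / 2.
Proof.
move=> kM; rewrite (@phaseE _ 1) ?mul1r// mul1n.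
exact: phase_steps_plateau.
Qed.

Lemma phase_middle k : (N - M <= k <= N + M)%N -> phase k = pi.
Proof.
move=> kM; rewrite (@phaseE _ 2); first by lra.
exact: phase_steps_middle.
Qed.

Lemma phase_end k : (N + 3 * M <= k)%N -> phase k = pi / 2 + pi.
Proof.
move=> kM; rewrite (@phaseE _ 3); first by lra.
exact: phase_steps_end.
Qed.

Lemma phase_period k : (k <= N - 3 * M)%N -> phase (k + N) = phase k + pi.
Proof.
move=> kM; rewrite /phase (phase_steps_period MN kM) !natrD !natrM.
by field; rewrite gt_eqF.
Qed.

(** Trading [pi / 2] for [2] keeps the later constants integral. *)
Let unit_le (x c : R) : 0 <= x <= c -> pi / 2 * x <= 2 * c.
Proof.
move=> /andP[x0 xc]; have p2 := pihalf_lt2 R; have p0 := pi_gt0 R.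
nra.
Qed.

Lemma phase_diff_le k : `|phase k.+1 - phase k| <= 6 / M%:R.
Proof.
have tri_le j : (minn j (2 * M - j) <= M)%N by lia.
rewrite /phase phase_stepsS natrD; set s := phase_steps N M k.
set d := (minn _ _ + _ + _)%N.
have dM : (d <= 3 * M)%N.
  rewrite /d (_ : (3 * M = M + M + M)%N); last by rewrite !mulSn mul0n addn0 addnA.
  by rewrite !leq_add//; exact: tri_le.
have -> : pi / 2 * (s%:R + d%:R) / M%:R ^+ 2 - pi / 2 * s%:R / M%:R ^+ 2 =
   (pi / 2 * d%:R) / M%:R ^+ 2 :> R by field; rewrite gt_eqF.
have p0 := pi_gt0 R.
rewrite ger0_norm; last first.
  by rewrite divr_ge0 ?exprn_ge0 ?(ltW M0)// mulr_ge0//; lra.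
have -> : 6 / M%:R = (2 * (3 * M)%:R) / M%:R ^+ 2 :> R.
  by rewrite natrM; field; rewrite gt_eqF.
rewrite ler_pM2r ?invr_gt0 ?exprn_gt0//; apply: unit_le.
by rewrite ler0n ler_nat.
Qed.

(** Each triangular increment changes by at most [1] from one index to the next; there are three of
    them, and [pi / 2 <= 2]. *)
Lemma phase_diff2_le k :
  `|phase k.+2 - 2 * phase k.+1 + phase k| <= 6 / M%:R ^+ 2.
Proof.
have step c : (minn (k.+1 - c) (2 * M - (k.+1 - c)) <=
      minn (k - c) (2 * M - (k - c)) + 1)%N /\
    (minn (k - c) (2 * M - (k - c)) <=
      minn (k.+1 - c) (2 * M - (k.+1 - c)) + 1)%N by split; lia.
rewrite /phase !phase_stepsS; set s := phase_steps N M k.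
set d := (minn (k - M) _ + _ + _)%N.
set e := (minn (k.+1 - M) _ + _ + _)%N.
have ed : (e <= d + 3)%N.
  rewrite /e /d (_ : (3 = 1 + 1 + 1)%N)// addnACA (addnACA (minn _ _)).
  by rewrite !leq_add ?(step _).1.
have de : (d <= e + 3)%N.
  rewrite /e /d (_ : (3 = 1 + 1 + 1)%N)// addnACA (addnACA (minn _ _)).
  by rewrite !leq_add ?(step _).2.
rewrite (natrD _ (s + d)%N e) (natrD _ s d).
have -> : pi / 2 * (s%:R + d%:R + e%:R) / M%:R ^+ 2 -
    2 * (pi / 2 * (s%:R + d%:R) / M%:R ^+ 2) +
    pi / 2 * s%:R / M%:R ^+ 2 = (pi / 2) * (e%:R - d%:R) / M%:R ^+ 2 :> R.
  by field; rewrite gt_eqF.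
have p0 := pi_gt0 R.
rewrite normrM [`|M%:R ^- 2|]ger0_norm ?invr_ge0 ?exprn_ge0 ?(ltW M0)//.
rewrite ler_pM2r ?invr_gt0 ?exprn_gt0// normrM [`|pi / 2|]ger0_norm; last lra.
have -> : 6 = 2 * 3 :> R by lra.
apply: unit_le; rewrite normr_ge0 ler_norml/=.
clearbody d e; move: ed de; rewrite -(ler_nat R) -(ler_nat R d) !natrD; lra.
Qed.

Lemma phase_dist_le k h : `|phase (k + h) - phase k| <= h%:R * (6 / M%:R).
Proof.
elim: h => [|h ih]; first by rewrite addn0 subrr normr0 mul0r.
rewrite addnS -natr1 mulrDl mul1r.
have -> : phase (k + h).+1 - phase k =
  (phase (k + h) - phase k) + (phase (k + h).+1 - phase (k + h)) by ring.
by apply: le_trans (ler_normD _ _) _; apply: lerD => //; exact: phase_diff_le.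
Qed.

(** The cuts here and in [cos_window] fall where the trigonometric factor is already zero, so the
    difference bounds survive them. *)
Definition sin_window (k : nat) : R := if (k < N)%N then sin (phase k) else 0.

Definition cos_window (k : nat) : R :=
  if (3 * M <= k)%N then cos (phase k) else 0.

Lemma sin_window_start k : (k <= M)%N -> sin_window k = 0.
Proof. by move=> kM; rewrite /sin_window phase_start// sin0 if_same. Qed.

Lemma sin_window_end k : (N - M <= k)%N -> sin_window k = 0.
Proof.
move=> kM; rewrite /sin_window; case: ifPn => // kN.
by rewrite phase_middle ?sinpi//; lia.
Qed.

Lemma sin_window_plateau k : (3 * M <= k <= N - 3 * M)%N -> sin_window k = 1.
Proof.
move=> kM; rewrite /sin_window phase_plateau// sin_pihalf ifT//.
by lia.
Qed.

Lemma cos_window_start k : (k <= N - 3 * M)%N -> cos_window k = 0.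
Proof.
move=> kM; rewrite /cos_window; case: ifPn => // kN.
by rewrite phase_plateau ?cos_pihalf//; lia.
Qed.

Lemma cos_window_end k : (N + 3 * M <= k)%N -> cos_window k = 0.
Proof.
move=> kM; rewrite /cos_window phase_end// cosDpi cos_pihalf oppr0.
by rewrite if_same.
Qed.

Lemma sin_window_le k : `|sin_window k| <= 1.
Proof.
by rewrite /sin_window; case: ifP; rewrite ?sin_max// normr0.
Qed.

Lemma cos_window_le k : `|cos_window k| <= 1.
Proof.
by rewrite /cos_window; case: ifP; rewrite ?cos_max// normr0.
Qed.

Lemma sin_window_diff_le k : `|sin_window k.+1 - sin_window k| <= 6 / M%:R.
Proof.
have [kN|kN] := ltnP k.+1 N.
  rewrite /sin_window kN (ltnW kN).
  exact: le_trans (normr_sinB _ _) (phase_diff_le _).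
by rewrite !sin_window_end ?subrr ?normr0//; lia.
Qed.

Lemma cos_window_diff_le k : `|cos_window k.+1 - cos_window k| <= 6 / M%:R.
Proof.
have [kN|kN] := leqP (3 * M) k.
  rewrite /cos_window kN (leq_trans kN)//.
  exact: le_trans (normr_cosB _ _) (phase_diff_le _).
by rewrite !cos_window_start ?subrr ?normr0//; lia.
Qed.

Lemma sin_window_diff2_le k :
  `|sin_window k.+2 - 2 * sin_window k.+1 + sin_window k| <=
  6 / M%:R ^+ 2 + (6 / M%:R) ^+ 2.
Proof.
have [kN|kN] := ltnP k.+2 N.
  rewrite /sin_window kN (ltnW kN) (ltnW (ltnW kN)).
  apply: sin_diff2_le; [exact: phase_diff_le..|exact: phase_diff2_le].
(* Since [M >= 2], all three indices lie at or beyond [N - M], where the window vanishes. *)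
by rewrite !sin_window_end ?mulr0 ?subrr ?addr0 ?normr0//; lia.
Qed.

Lemma cos_window_diff2_le k :
  `|cos_window k.+2 - 2 * cos_window k.+1 + cos_window k| <=
  6 / M%:R ^+ 2 + (6 / M%:R) ^+ 2.
Proof.
have [kN|kN] := leqP (3 * M) k.
  have k1 : (3 * M <= k.+1)%N by lia.
  have k2 : (3 * M <= k.+2)%N by lia.
  rewrite /cos_window kN k1 k2.
  apply: cos_diff2_le; [exact: phase_diff_le..|exact: phase_diff2_le].
by rewrite !cos_window_start ?mulr0 ?subrr ?addr0 ?normr0//; lia.
Qed.

Definition window_corr (h l : nat) : R :=
  sin_window (l + h) * sin_window l + cos_window (l + h) * cos_window l.

(** A discrete Leibniz rule centred at [l + 1]: each of the two products contributes
    [2 (6 + 36) + 2 * 36 = 156]. *)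
Lemma window_corr_diff2_le h l :
  `|window_corr h l.+2 - 2 * window_corr h l.+1 + window_corr h l| <=
  312 / M%:R ^+ 2.
Proof.
have prod_le (f0 f1 f2 g0 g1 g2 a c : R) : `|f1| <= 1 -> `|g1| <= 1 ->
    `|f1 - f0| <= a -> `|f2 - f1| <= a -> `|g1 - g0| <= a -> `|g2 - g1| <= a ->
    `|f2 - 2 * f1 + f0| <= c -> `|g2 - 2 * g1 + g0| <= c ->
    `|f2 * g2 - 2 * (f1 * g1) + f0 * g0| <= 2 * c + 2 * a ^+ 2.
  move=> hf hg f10 f21 g10 g21 ff gg.
  have -> : f2 * g2 - 2 * (f1 * g1) + f0 * g0 = (f2 - 2 * f1 + f0) * g1 +
    f1 * (g2 - 2 * g1 + g0) + (f2 - f1) * (g2 - g1) + (f1 - f0) * (g1 - g0).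
    by ring.
  have -> : 2 * c + 2 * a ^+ 2 = c * 1 + 1 * c + a * a + a * a by ring.
  have prodP (x y u t : R) : `|x| <= u -> `|y| <= t -> `|x * y| <= u * t.
    by move=> ? ?; rewrite normrM ler_pM.
  apply: le_trans (ler_normD _ _) _; apply: lerD; last exact: prodP.
  apply: le_trans (ler_normD _ _) _; apply: lerD; last exact: prodP.
  by apply: le_trans (ler_normD _ _) _; apply: lerD; exact: prodP.
have := prod_le _ _ _ _ _ _ _ _ (sin_window_le (l + h).+1) (sin_window_le l.+1)
  (sin_window_diff_le _) (sin_window_diff_le _) (sin_window_diff_le _)
  (sin_window_diff_le _) (sin_window_diff2_le _) (sin_window_diff2_le _).
have := prod_le _ _ _ _ _ _ _ _ (cos_window_le (l + h).+1) (cos_window_le l.+1)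
  (cos_window_diff_le _) (cos_window_diff_le _) (cos_window_diff_le _)
  (cos_window_diff_le _) (cos_window_diff2_le _) (cos_window_diff2_le _).
rewrite /window_corr !addSn => hc hs.
have -> : 312 / M%:R ^+ 2 = (2 * (6 / M%:R ^+ 2 + (6 / M%:R) ^+ 2) +
   2 * (6 / M%:R) ^+ 2) + (2 * (6 / M%:R ^+ 2 + (6 / M%:R) ^+ 2) +
   2 * (6 / M%:R) ^+ 2) :> R by field; rewrite gt_eqF.
apply: le_trans (lerD hs hc); apply: le_trans (ler_normD _ _).
by rewrite le_eqVlt; apply/orP; left; apply/eqP; congr `|_|; ring.
Qed.

(** The windows are supported on intervals of length [N - 2M] and [6M <= N - 2M], so a shift by [h]
    separates the two factors. *)
Lemma window_corr_far h l : (N - 2 * M <= h)%N -> window_corr h l = 0.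
Proof.
move=> hN; rewrite /window_corr.
have -> : sin_window (l + h) * sin_window l = 0.
  have [lM|Ml] := leqP l M; first by rewrite (sin_window_start lM) mulr0.
  by rewrite sin_window_end ?mul0r//; lia.
have [lM|Ml] := leqP l (N - 3 * M).
  by rewrite (cos_window_start lM) mulr0 addr0.
by rewrite cos_window_end ?mul0r ?addr0//; lia.
Qed.

Lemma window_corr_start h l : (l <= M)%N -> window_corr h l = 0.
Proof.
move=> lM; rewrite /window_corr (sin_window_start lM) mulr0 add0r.
by rewrite (@cos_window_start l) ?mulr0//; lia.
Qed.

Lemma window_corr_end h l : (N + 3 * M <= l)%N -> window_corr h l = 0.
Proof.
move=> lM; rewrite /window_corr (cos_window_end lM) mulr0 addr0.
by rewrite (@sin_window_end l) ?mulr0//; lia.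
Qed.

(** As [x ^+ h] has period dividing [N], the cosine terms beyond [N] fold back onto [[0, 3M)], where
    they supply the part cut off from the window. The products then combine by the formula for the
    cosine of a difference. *)
Lemma sum_window_corr (x : R[i]) (h L : nat) : x ^+ N = 1 -> (h <= M)%N ->
  (N + 3 * M <= L)%N ->
  \sum_(0 <= l < L) (window_corr h l)%:C * (x ^+ h) ^+ l =
  \sum_(0 <= l < N) (cos (phase (l + h) - phase l))%:C * (x ^+ h) ^+ l.
Proof.
move=> xN hM NL; set y := x ^+ h.
have yN : y ^+ N = 1 by rewrite /y -exprM mulnC exprM xN expr1n.
transitivity (\sum_(0 <= l < L) (sin_window (l + h) * sin_window l)%:C * y ^+ l +
   \sum_(0 <= l < L) (cos_window (l + h) * cos_window l)%:C * y ^+ l).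
  by rewrite -big_split /=; apply: eq_bigr => l _; rewrite -mulrDl -rmorphD.
have -> : \sum_(0 <= l < L) (sin_window (l + h) * sin_window l)%:C * y ^+ l =
   \sum_(0 <= l < N) (sin (phase (l + h)) * sin (phase l))%:C * y ^+ l.
  rewrite (@big_cat_nat _ _ _ N)//=; last lia.
  rewrite [X in _ + X]big_nat_cond [X in _ + X]big1 ?addr0; last first.
    move=> l /andP[/andP[Nl _] _].
    by rewrite (@sin_window_end l) ?mulr0 ?mul0r//; lia.
  apply: eq_big_nat => l /andP[_ lN]; congr ((_)%:C * _).
  rewrite {2}/sin_window lN /sin_window; case: ltnP => // Nlh.
  by rewrite (@phase_middle l) ?sinpi ?mulr0//; lia.
have -> : \sum_(0 <= l < L) (cos_window (l + h) * cos_window l)%:C * y ^+ l =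
   \sum_(0 <= l < N) (cos (phase (l + h)) * cos (phase l))%:C * y ^+ l.
  rewrite (@big_cat_nat _ _ _ (3 * M))//=; last lia.
  rewrite [X in X + _]big_nat_cond [X in X + _]big1 ?add0r; last first.
    move=> l /andP[/andP[_ lM] _].
    by rewrite (@cos_window_start l) ?mulr0 ?mul0r//; lia.
  rewrite (@big_cat_nat _ _ _ (N + 3 * M))//=; last lia.
  rewrite [X in _ + X]big_nat_cond [X in _ + X]big1 ?addr0; last first.
    move=> l /andP[/andP[Nl _] _].
    by rewrite (@cos_window_end l) ?mulr0 ?mul0r//; lia.
  rewrite (eq_big_nat _ _ (F2 := fun l =>
      (cos (phase (l + h)) * cos (phase l))%:C * y ^+ l)); last first.
    move=> l /andP[Ml _]; rewrite /cos_window Ml ifT//; lia.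
  rewrite (@big_cat_nat _ _ _ N)//=; [|lia|lia].
  rewrite [RHS](@big_cat_nat _ _ _ (3 * M))//=; last lia.
  rewrite [RHS]addrC; congr (_ + _).
  rewrite -{1}(add0n N) (addnC N) big_addn addnK.
  apply: eq_big_nat => l /andP[_ lM]; rewrite exprD yN mulr1.
  congr ((_)%:C * _).
  (* Both phases gain [pi], and the two sign changes cancel. *)
  have -> : (l + N + h = l + h + N)%N by lia.
  rewrite !phase_period; [|lia|lia].
  by rewrite !cosDpi mulrNN.
by rewrite -big_split /=; apply: eq_bigr => l _;
  rewrite -mulrDl -rmorphD cosB addrC.
Qed.

Lemma normc_sum_window_corr_near (x : R[i]) (h L : nat) :
  N.-primitive_root x -> (0 < h <= M)%N -> (N + 3 * M <= L)%N ->
  normc (\sum_(0 <= l < L) (window_corr h l)%:C * (x ^+ h) ^+ l) <=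
  18 * N%:R * h%:R ^+ 2 / M%:R ^+ 2.
Proof.
move=> xN /andP[h0 hM] NL.
rewrite sum_window_corr//; last exact: prim_expr_order.
have x1 := normc_prim_root xN.
have s0 : \sum_(0 <= l < N) (x ^+ h) ^+ l = 0.
  rewrite big_mkord -[RHS](sum_prim_root (m := h) xN); last by rewrite gtnNdvd//; lia.
  by apply: eq_bigr => l _; rewrite -!exprM mulnC.
(* Subtracting the vanishing geometric sum leaves [1 - cos], at most
   [(6 h / M)^2 / 2 = 18 h^2 / M^2]. *)
have -> : \sum_(0 <= l < N) (cos (phase (l + h) - phase l))%:C * (x ^+ h) ^+ l =
   - \sum_(0 <= l < N) (1 - cos (phase (l + h) - phase l))%:C * (x ^+ h) ^+ l.
  transitivity (\sum_(0 <= l < N) (cos (phase (l + h) - phase l))%:C * (x ^+ h) ^+ l -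
    \sum_(0 <= l < N) (x ^+ h) ^+ l); first by rewrite s0 subr0.
  rewrite -sumrB -sumrN; apply: eq_bigr => l _.
  by rewrite rmorphB rmorph1; ring.
rewrite normcN; apply: le_trans (normc_sum _ _ _) _.
have -> : 18 * N%:R * h%:R ^+ 2 / M%:R ^+ 2 =
   \sum_(0 <= l < N) ((h%:R * (6 / M%:R)) ^+ 2 / 2) :> R.
  by rewrite sumr_const_nat subn0 -mulr_natl; field; rewrite gt_eqF.
apply: ler_sum => l _.
rewrite normcM !normcX x1 !expr1n mulr1 normc_real ger0_norm; last first.
  by rewrite subr_ge0 cos_le1.
apply: le_trans (oneBcos_le _) _; rewrite ler_pM2r ?invr_gt0//.
rewrite -(real_normK (num_real (phase _ - _))).
by rewrite ler_pXn2r ?nnegrE ?phase_dist_le// mulr_ge0.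
Qed.

Lemma normc_sum_window_corr_far (h L : nat) :
  (0 < h < N)%N -> (N + 3 * M <= L)%N ->
  normc (\sum_(0 <= l < L) (window_corr h l)%:C *
    (expi (2 * pi / N%:R) ^+ h) ^+ l) <=
  78 * L%:R * N%:R ^+ 4 / M%:R ^+ 4 / h%:R ^+ 2.
Proof.
move=> /andP[h0 hN] NL; set x : R[i] := expi _.
have N0 : 0 < N%:R :> R by rewrite ltr0n; lia.
have hh0 : 0 < h%:R :> R by rewrite ltr0n; lia.
(* For [h] near [N] the chord degenerates, but the correlation is zero there. *)
have [hfar|hnear] := leqP (N - 2 * M) h.
  rewrite big1 ?normc0; first by rewrite !(divr_ge0, mulr_ge0, exprn_ge0).
  by move=> l _; rewrite window_corr_far// mul0r.
have x1 : normc x = 1 by exact: normc_expi.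
have x1h : normc (x ^+ h) = 1 by rewrite normcX x1 expr1n.
have := @normc_sum_second_difference R (window_corr h) (x ^+ h) L
  (312 / M%:R ^+ 2) (window_corr_start h (leq0n _)) (window_corr_start h (ltnW M2))
  _ x1h (window_corr_diff2_le h).
move=> /(_ (fun l lL => window_corr_end h (leq_trans NL lL))).
set S := normc (\sum_(0 <= l < L) _) => HS.
(* Both [h] and [N - h >= 2M] are at least [M h / N], and [pi >= 2]. Squaring this bound turns [312]
   into [312 / 4 = 78]. *)
have low : 2 * (M%:R * h%:R / N%:R ^+ 2) <= normc (1 - x ^+ h).
  apply: le_trans (normc_oneBexpi_ge R hN).
  have -> : 2 * (M%:R * h%:R / N%:R ^+ 2) = 2 * (M%:R * h%:R / N%:R) / N%:R :> R.
    by field; rewrite gt_eqF.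
  rewrite ler_pM2r ?invr_gt0//; apply: ler_pM => //.
    exact: pi_ge2.
  rewrite le_min; apply/andP; split; rewrite ler_pdivrMr// -!natrM ler_nat.
    by nia.
  have [e Ne] : exists e, N = (h + 2 * M + e)%N by exists (N - h - 2 * M)%N; lia.
  nia.
have q0 : 0 < 2 * (M%:R * h%:R / N%:R ^+ 2) :> R.
  by apply: mulr_gt0 => //; apply: divr_gt0; [exact: mulr_gt0|exact: exprn_gt0].
have q2 : (2 * (M%:R * h%:R / N%:R ^+ 2)) ^+ 2 * S <= L%:R * (312 / M%:R ^+ 2).
  apply: le_trans HS; apply: ler_wpM2r; first exact: normc_ge0.
  by rewrite ler_pXn2r ?nnegrE ?normc_ge0// ltW.
rewrite -(ler_pM2l (exprn_gt0 2 q0)); apply: le_trans q2 _.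
rewrite le_eqVlt; apply/orP; left; apply/eqP.
by field; rewrite !gt_eqF.
Qed.

End windows.

(** * Flat polynomials with almost unimodular coefficients *)

Section chirp_polynomial.
Variables (R : realType) (N M : nat).
Hypotheses (M2 : (2 <= M)%N) (MN : (8 * M <= N)%N).

Definition chirp_poly : {poly R[i]} :=
  \poly_(k < N) ((sin_window R N M k)%:C * expi (2 * pi / N%:R) ^+ 'C(k, 2)).

(** The diagonals are split at [H]: up to [H] the near-cancellation bound is used, beyond it the
    summation by parts. *)
Lemma normc_chirp_poly_le (H : nat) (z : R[i]) :
  (0 < H <= M)%N -> normc z = 1 ->
  normc chirp_poly.[z] ^+ 2 <=
    N%:R * (1 + 36 * H%:R ^+ 3 / M%:R ^+ 2 + 312 * N%:R ^+ 4 / M%:R ^+ 4 / H%:R).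
Proof.
move=> /andP[H0 HM] z1; pose x : R[i] := expi (2 * pi / N%:R).
have N0 : (0 < N)%N by lia.
have M0' : 0 < M%:R :> R by rewrite ltr0n; lia.
have H0' : 0 < H%:R :> R by rewrite ltr0n.
have N0' : 0 < N%:R :> R by rewrite ltr0n.
have xN : N.-primitive_root x by exact: expi_prim_root.
have x1 : normc x = 1 by exact: normc_expi.
pose w := sin_window R N M; pose v := cos_window R N M.
have NK : (N + 3 * M <= 2 * N)%N by lia.
have PE : chirp_poly.[z] = \sum_(0 <= k < 2 * N) (w k)%:C * x ^+ 'C(k, 2) * z ^+ k.
  rewrite /chirp_poly horner_poly -/x -/w.
  rewrite -(big_mkord xpredT (fun k => (w k)%:C * x ^+ 'C(k, 2) * z ^+ k)).
  rewrite [RHS](@big_cat_nat _ _ _ N)//=; last lia.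
  rewrite [X in _ = _ + X]big_nat_cond [X in _ = _ + X]big1 ?addr0//.
  move=> k /andP[/andP[Nk _] _].
  by rewrite /w (sin_window_end R M2 MN) ?mul0r//; lia.
rewrite PE; apply: le_trans (normc_chirp_le w v _ x1 z1) _.
(* The main diagonal is the case [h = 0] of the folding identity, where every cosine is [1]. *)
have -> : \sum_(0 <= k < 2 * N) (w k ^+ 2 + v k ^+ 2) = N%:R.
  apply: complexI; rewrite rmorph_nat rmorph_sum /=.
  transitivity (\sum_(0 <= l < 2 * N) (window_corr R N M 0 l)%:C * (x ^+ 0) ^+ l).
    by apply: eq_bigr => l _; rewrite expr0 expr1n mulr1 /window_corr addn0 -!expr2.
  rewrite (sum_window_corr M2 MN (prim_expr_order xN) (leq0n M) NK).
  rewrite (eq_bigr (fun=> 1)); first by rewrite sumr_const_nat subn0.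
  by move=> l _; rewrite addn0 subrr cos0 expr0 expr1n mulr1.
pose T h := normc (\sum_(0 <= l < 2 * N) (window_corr R N M h l)%:C * (x ^+ h) ^+ l).
(* The added terms have [l + h >= 2N], beyond the support of both windows. *)
have -> : \sum_(1 <= h < 2 * N) normc (\sum_(0 <= l < 2 * N - h)
    (w (l + h)%N * w l + v (l + h)%N * v l)%:C * (x ^+ h) ^+ l) =
    \sum_(1 <= h < 2 * N) T h.
  apply: eq_big_nat => h /andP[h1 hK]; rewrite /T; congr normc.
  rewrite [RHS](@big_cat_nat _ _ _ (2 * N - h))//=; last lia.
  rewrite [X in _ = _ + X]big_nat_cond [X in _ = _ + X]big1 ?addr0//.
  move=> l /andP[/andP[Nl _] _]; rewrite /window_corr.
  rewrite (@sin_window_end R N M M2 MN (l + h)); last lia.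
  by rewrite (@cos_window_end R N M M2 MN (l + h)) ?mul0r ?addr0 ?mul0r//; lia.
have near : \sum_(1 <= h < H.+1) T h <= 18 * N%:R * H%:R ^+ 3 / M%:R ^+ 2.
  have -> : 18 * N%:R * H%:R ^+ 3 / M%:R ^+ 2 =
      \sum_(1 <= h < H.+1) (18 * N%:R * H%:R ^+ 2 / M%:R ^+ 2) :> R.
    rewrite sumr_const_nat subSS subn0 -mulr_natl; field; rewrite gt_eqF//.
  apply: ler_sum_nat => h /andP[h1 hH].
  apply: le_trans (normc_sum_window_corr_near M2 MN xN _ NK) _; first lia.
  rewrite ler_pM2r ?invr_gt0 ?exprn_gt0// ler_pM2l ?mulr_gt0//.
  by rewrite ler_pXn2r ?nnegrE// ler_nat.
have far : \sum_(H.+1 <= h < 2 * N) T h <=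
    156 * N%:R ^+ 5 / M%:R ^+ 4 * H%:R^-1.
  apply: le_trans (_ : \sum_(H.+1 <= h < 2 * N)
    (156 * N%:R ^+ 5 / M%:R ^+ 4 * (h%:R ^+ 2)^-1) <= _); last first.
    rewrite -mulr_sumr ler_pM2l ?sum_inv_sqr_le//.
    by apply: divr_gt0; [apply: mulr_gt0 => //|]; exact: exprn_gt0.
  apply: ler_sum_nat => h /andP[h1 hK].
  have [hN|Nh] := ltnP h N.
    apply: le_trans (@normc_sum_window_corr_far R N M M2 MN h (2 * N) _ NK) _.
      by apply/andP; split => //; lia.
    rewrite natrM le_eqVlt; apply/orP; left; apply/eqP; field.
    by rewrite !gt_eqF// ltr0n; lia.
  rewrite /T big1; last first.
    by move=> l _; rewrite (window_corr_far R M2 MN) ?mul0r//; lia.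
  rewrite normc0; apply: mulr_ge0; last by rewrite invr_ge0 exprn_ge0.
  by apply: divr_ge0; [apply: mulr_ge0 => //|]; apply: exprn_ge0; exact: ltW.
rewrite (@big_cat_nat _ _ _ H.+1)//=; last lia.
have -> : N%:R * (1 + 36 * H%:R ^+ 3 / M%:R ^+ 2 + 312 * N%:R ^+ 4 / M%:R ^+ 4 / H%:R) =
  N%:R + 2 * (18 * N%:R * H%:R ^+ 3 / M%:R ^+ 2 +
    156 * N%:R ^+ 5 / M%:R ^+ 4 * H%:R^-1) :> R.
  by field; rewrite !gt_eqF.
by rewrite lerD2l ler_pM2l// lerD.
Qed.

Lemma sum_normc_chirp_poly_ge :
  (N - 6 * M)%:R <= \sum_(k < N) normc chirp_poly`_k.
Proof.
rewrite -(big_mkord xpredT (fun k => normc chirp_poly`_k)).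
have P0 a b : 0 <= \sum_(a <= k < b) normc chirp_poly`_k.
  by apply: sumr_ge0 => k _; exact: normc_ge0.
rewrite (@big_cat_nat _ _ _ (3 * M))//=; last lia.
rewrite [X in _ + X](@big_cat_nat _ _ _ (N - 3 * M))//=; [|lia|lia].
have -> : (N - 6 * M)%:R = \sum_(3 * M <= k < N - 3 * M) 1 :> R.
  by rewrite sumr_const_nat; congr (_%:R); lia.
apply: le_trans (_ : \sum_(3 * M <= k < N - 3 * M) normc chirp_poly`_k <= _).
  apply: ler_sum_nat => k /andP[k1 k2]; rewrite coef_poly ifT; last lia.
  rewrite (sin_window_plateau R M2 MN); last lia.
  by rewrite normcM normcX normc_expi expr1n mulr1 normc_real normr1.
by rewrite addrA -[leLHS]add0r -[leLHS]addr0 !lerD.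
Qed.

End chirp_polynomial.

(** With [q] and [H] fixed in terms of [e], and [N = q M], let [M] grow: the ramps occupy a
    proportion [6 / q] of the coefficients. *)
Lemma chirp_poly_asymptotic (R : realType) (e : R) : 0 < e ->
  exists n0, forall n, (n0 <= n)%N -> exists P : {poly R[i]}, exists B : R,
  [/\ (size P <= n.+1)%N, 0 < B, forall z, normc z = 1 -> normc P.[z] <= B &
      (1 - e) * Num.sqrt n.+1%:R * B <= \sum_(k < n.+1) normc P`_k].
Proof.
move=> e0.
have [q q9 qe] : exists2 q : nat, (9 <= q)%N & 9 / q%:R <= e.
  exists (Num.truncn (9 / e)).+1.+1.+4.+4; first lia.
  rewrite ler_pdivrMr ?ltr0n// mulrC -ler_pdivrMr//.
  have := truncnS_gt (9 / e); move/ltW/le_trans; apply.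
  by rewrite ler_nat; move: (Num.truncn _) => k; lia.
have q0 : 0 < q%:R :> R by rewrite ltr0n; lia.
(* As [N / M = q], this makes the far error exactly [1 / q]; the near error is at most [1 / q] once
   [36 H^3 q <= M]. *)
have [H H0 HE] : exists2 H, (0 < H)%N & H%:R = 312 * q%:R ^+ 5 :> R.
  exists (312 * q ^ 5)%N; last by rewrite natrM natrX.
  by rewrite muln_gt0 expn_gt0; lia.
exists (q * (36 * H ^ 3 * q))%N => n n0n; pose M := (n.+1 %/ q)%N; pose N := (q * M)%N.
have qM : (36 * H ^ 3 * q <= M)%N by rewrite leq_divRL; [rewrite mulnC; lia|lia].
have Nn : (N <= n.+1)%N by rewrite /N mulnC leq_divM.
have nN : (n.+1 <= N + q)%N.
  by rewrite {1}(divn_eq n.+1 q) -/M /N mulnC leq_add2l ltnW// ltn_pmod; lia.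
have H3 : (H <= H ^ 3)%N by rewrite -{1}(expn1 H) leq_pexp2l.
have HM : (H <= M)%N by nia.
have qM' : (q <= M)%N by nia.
have M2 : (2 <= M)%N by lia.
have MN : (8 * M <= N)%N by rewrite /N; nia.
have M0 : 0 < M%:R :> R by rewrite ltr0n; lia.
have HR0 : 0 < H%:R :> R by rewrite ltr0n.
have N0 : 0 < N%:R :> R by rewrite ltr0n; lia.
have NE : N%:R = q%:R * M%:R :> R by rewrite natrM.
pose t : R := q%:R^-1.
have t0 : 0 < t by rewrite invr_gt0.
have tq : t * q%:R = 1 by rewrite mulVf// gt_eqF.
have t9 : 9 * t <= 1.
  by rewrite /t ler_pdivrMr// mul1r (ler_nat _ 9).
have NB0 : 0 < N%:R * (1 + 2 * t) by apply: mulr_gt0 => //; lra.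
exists (chirp_poly R N M), (Num.sqrt (N%:R * (1 + 2 * t))); split.
- by apply: leq_trans Nn; exact: size_poly.
- by rewrite sqrtr_gt0.
- move=> z z1; rewrite -[leLHS]ger0_norm ?normc_ge0// -sqrtr_sqr.
  rewrite ler_wsqrtr//.
  apply: le_trans (normc_chirp_poly_le M2 MN (H := H) _ z1) _; first by rewrite H0.
  rewrite ler_pM2l//.
  have -> : 312 * N%:R ^+ 4 / M%:R ^+ 4 / H%:R = t.
    rewrite NE HE /t; field.
    by rewrite !gt_eqF.
  have : 36 * H%:R ^+ 3 / M%:R ^+ 2 <= t.
    rewrite /t ler_pdivrMr ?exprn_gt0// ler_pdivlMl// mulrC.
    have -> : 36 * H%:R ^+ 3 * q%:R = (36 * H ^ 3 * q)%:R :> R.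
      by rewrite (natrM _ (36 * H ^ 3)%N q) (natrM _ 36 (H ^ 3)%N) natrX.
    rewrite -natrX ler_nat; apply: leq_trans qM _.
    by rewrite -{1}(expn1 M) leq_pexp2l// ltnW.
  lra.
have sub : \sum_(k < N) normc (chirp_poly R N M)`_k <=
     \sum_(k < n.+1) normc (chirp_poly R N M)`_k.
  rewrite (big_ord_widen_cond n.+1 xpredT (fun k => normc (chirp_poly R N M)`_k))//.
  by rewrite [leLHS]big_mkcond /=; apply: ler_sum => k _; case: ifP => // _; exact: normc_ge0.
apply: le_trans sub; apply: le_trans (sum_normc_chirp_poly_ge R M2 MN).
have N6M : (6 * M <= N)%N by apply: leq_trans MN; rewrite leq_mul2r orbT.
rewrite (natrB _ N6M) natrM; set B := Num.sqrt (_ * _).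
have B0 : 0 <= B by exact: sqrtr_ge0.
have B2 : B ^+ 2 = N%:R * (1 + 2 * t) by rewrite sqr_sqrtr// ltW.
(* Rounding loses at most [q <= M], while [B ^+ 2 = N + 2M]. *)
have nB : Num.sqrt n.+1%:R <= B.
  rewrite ler_wsqrtr//; apply: le_trans (_ : (N + q)%:R <= _).
    by rewrite ler_nat.
  rewrite natrD mulrDr mulr1 lerD2l NE.
  have -> : q%:R * M%:R * (2 * t) = 2 * M%:R * (t * q%:R) by ring.
  rewrite tq mulr1; have : q%:R <= M%:R :> R by rewrite ler_nat.
  lra.
have te : 9 * t <= e by [].
have s0 : 0 <= Num.sqrt n.+1%:R :> R by exact: sqrtr_ge0.
(* It remains to see that [(1 - 9t)(1 + 2t) <= 1 - 6t], as [N - 6M = (1 - 6t) N]. *)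
apply: le_trans (_ : (1 - 9 * t) * B ^+ 2 <= _).
  rewrite expr2 mulrA; apply: ler_wpM2r => //.
  apply: le_trans (_ : (1 - 9 * t) * Num.sqrt n.+1%:R <= _).
    by apply: ler_wpM2r => //; lra.
  by apply: ler_wpM2l => //; lra.
have ME : M%:R = t * N%:R by rewrite NE mulrA tq mul1r.
rewrite B2 ME; have : 0 <= N%:R * t by rewrite mulr_ge0// ltW.
have : 0 <= N%:R * t ^+ 2 by rewrite mulr_ge0 ?sqr_ge0// ltW.
nra.
Qed.

(* A weak bound for [p ^+ m], with a constant independent of [m], is
   sharpened by letting [m] tend to infinity. *)
Lemma maximum_modulus (R : realType) (p : {poly R[i]}) (B : R) :
  (forall z, normc z = 1 -> normc p.[z] <= B) ->
  forall z, normc z < 1 -> normc p.[z] <= B.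
Proof.
move=> pB z z1; have z0 := normc_ge0 z; set r := normc z in z1 z0.
have B0 : 0 <= B by apply: le_trans (pB 1 (normc1 _)); exact: normc_ge0.
(* Fourier inversion bounds every coefficient of [p ^+ m] by [B ^+ m], and a geometric series in [r]
   does the rest. *)
have weak (m : nat) : normc p.[z] ^+ m <= B ^+ m * (1 - r)^-1.
  pose P := p ^+ m; pose N := (size P).+1.
  have wN : N.-primitive_root (expi (2 * pi / N%:R) : R[i]) by exact: expi_prim_root.
  set w := expi _ in wN.
  have coefP (k : 'I_N) : normc P`_k <= B ^+ m.
    have N0 : 0 < N%:R :> R by rewrite ltr0n.
    have := @sum_horner_prim_root _ N k w P wN (leqnSn _) (ltn_ord k).
    move/(congr1 (@normc R)); rewrite normcM.
    have -> : normc (N%:R : R[i]) = N%:R.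
      have -> : (N%:R : R[i]) = (N%:R)%:C by rewrite rmorph_nat.
      by rewrite normc_real normr_nat.
    move=> E; rewrite -(ler_pM2l N0) -E; apply: le_trans (normc_sum _ _ _) _.
    have -> : N%:R * B ^+ m = \sum_(j < N) B ^+ m by rewrite sumr_const card_ord mulr_natl.
    apply: ler_sum => j _.
    rewrite normcM normcV !normcX (normc_prim_root wN) !expr1n invr1 mulr1.
    rewrite /P horner_exp normcX lerXn2r ?nnegrE ?normc_ge0//.
    by apply: pB; rewrite normcX (normc_prim_root wN) expr1n.
  rewrite -normcX -horner_exp -/P (horner_coef_wide _ (leqnSn _)).
  apply: le_trans (normc_sum _ _ _) _.
  apply: le_trans (_ : \sum_(k < N) B ^+ m * r ^+ k <= _).
    by apply: ler_sum => k _; rewrite normcM normcX ler_wpM2r ?exprn_ge0.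
  rewrite -mulr_sumr ler_wpM2l ?exprn_ge0//.
  have r1 : 0 < 1 - r by rewrite subr_gt0.
  rewrite -(ler_pM2l r1) divff ?gt_eqF//.
  have -> : (1 - r) * \sum_(k < N) r ^+ k = 1 - r ^+ N.
    by rewrite -[RHS]opprB subrX1 -mulNr opprB.
  by rewrite gerBl exprn_ge0.
rewrite leNgt; apply/negP => Bp.
have [B00|Bn0] := eqVneq B 0.
  have := weak 1%N; rewrite !expr1 B00 mul0r; move: Bp; rewrite B00; lra.
have Bp0 : 0 < B by rewrite lt_neqAle eq_sym Bn0.
(* If the ratio exceeded [1], its powers would grow at least linearly in [m], against the uniform
   bound [(1 - r)^-1]. *)
pose d := normc p.[z] / B - 1.
have d0 : 0 < d by rewrite subr_gt0 ltr_pdivlMr// mul1r.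
have bern (m : nat) : m%:R * d <= (1 + d) ^+ m.
  elim: m => [|m ih]; first by rewrite mul0r expr0.
  have : 1 <= (1 + d) ^+ m by rewrite exprn_ege1// lerDl ltW.
  rewrite exprS -natr1; move: ih d0; set y := (1 + d) ^+ m; nra.
have {}weak (m : nat) : (1 + d) ^+ m <= (1 - r)^-1.
  rewrite addrC subrK expr_div_n ler_pdivrMr ?exprn_gt0// mulrC.
  exact: weak.
have := truncnS_gt ((1 - r)^-1 / d); rewrite ltNge => /negP; apply.
by rewrite ler_pdivlMr//; exact: le_trans (bern _) (weak _).
Qed.

(** * Norms of polynomials *)

Lemma is_derive_horner_num (K : numFieldType) (p : {poly K}) (x : K) :
  is_derive (x : K^o) (1 : K^o) (horner p : K^o -> K^o) p^`().[x].
Proof.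
elim/poly_ind: p => [|p c ih].
  rewrite deriv0 horner0 (_ : horner 0 = cst 0); first exact: is_derive_cst.
  by apply/funext => y; rewrite horner0.
rewrite (_ : horner (p * 'X + c%:P) =
    (fun y : K^o => (p.[y] : K^o) * y + c : K^o)); last first.
  by apply/funext => y; rewrite !hornerE.
have h1 : is_derive (x : K^o) (1 : K^o) (fun y : K^o => (p.[y] : K^o) * y : K^o)
   (p.[x] *: 1 + x *: p^`().[x]) by exact: is_deriveM.
have h2 := is_deriveD h1 (is_derive_cst (c : K^o) (x : K^o) (1 : K^o)).
apply: is_derive_eq h2 _.
rewrite addr0 derivD derivC addr0 derivM derivX mulr1 hornerD hornerMX.
by rewrite /GRing.scale /= mulr1 addrC mulrC.
Qed.

Lemma complex_derive_horner (R : realType) (p : {poly R[i]}) :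
  complex_derive (horner p) = horner p^`().
Proof.
apply/funext => x; rewrite /complex_derive derive1E.
exact: (@derive_val _ _ _ _ _ _ _ (is_derive_horner_num p x)).
Qed.

(** The integral of a nonnegative function is a supremum over the simple functions below it, hence
    monotone. This is applied to the sup norms of the dilated derivative. *)
Lemma ge0_le_integral_nonmeasurable d (T : measurableType d) (R : realType)
    (mu : {measure set T -> \bar R}) (D : set T) (f g : T -> \bar R) :
  (forall x, D x -> (0 <= f x)%E) -> (forall x, D x -> (f x <= g x)%E) ->
  (\int[mu]_(x in D) f x <= \int[mu]_(x in D) g x)%E.
Proof.
move=> f0 fg; have g0 x : D x -> (0 <= g x)%E.
  by move=> Dx; apply: le_trans (f0 x Dx) (fg x Dx).
rewrite integral_mkcond [leRHS]integral_mkcond !ge0_integralTE; last 2 first.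
- by move=> x; exact: erestrict_ge0.
- by move=> x; exact: erestrict_ge0.
apply: le_ereal_sup => _ [h hf <-]; exists h => // x.
apply: le_trans (hf x) _; exact: lee_restrict.
Qed.

Lemma integral_even_powers (R : realType) (n : nat) (S : R) :
  (\int[lebesgue_measure]_(r in `[0%R, 1%R]%classic)
     ((\sum_(k < n) r ^+ k.*2) * S)%:E =
   ((\sum_(0 <= k < n) (2 * k + 1)%:R^-1) * S)%:E)%E.
Proof.
pose p : {poly R} := \sum_(k < n) S *: 'X^(k.*2).
pose q : {poly R} := \sum_(k < n) (S / (2 * k + 1)%:R) *: 'X^(k.*2.+1).
have qp : q^`() = p.
  rewrite /q /p raddf_sum; apply: eq_bigr => k _ /=.
  rewrite derivZ derivXn -(scaler_nat k.*2.+1) scalerA; congr (_ *: _).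
  have -> : (k.*2.+1 = 2 * k + 1)%N by lia.
  by rewrite divfK// pnatr_eq0; lia.
have pE (r : R) : (\sum_(k < n) r ^+ k.*2) * S = p.[r].
  rewrite /p horner_sum mulr_suml; apply: eq_bigr => k _.
  by rewrite hornerZ hornerXn mulrC.
under eq_integral => r _ do rewrite pE.
rewrite (@continuous_FTC2 _ (horner p) (horner q))//.
- rewrite -EFinB; congr _%:E; rewrite !horner_sum -sumrB big_mkord mulr_suml.
  apply: eq_bigr => k _; rewrite !hornerZ !hornerXn expr1n expr0n /= mulr0 subr0.
  by rewrite mulr1 mulrC.
- by apply: continuous_subspaceT => x; exact: continuous_horner.
- split.
  + by move=> x _; exact: derivable_horner.
  + by apply: cvg_at_right_filter; exact: continuous_horner.
  + by apply: cvg_at_left_filter; exact: continuous_horner.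
- by move=> x _; rewrite -derivE qp.
Qed.

Lemma bernoulli_oneB (R : realFieldType) (d : R) (m : nat) :
  0 <= d -> d <= 1 -> 1 - m%:R * d <= (1 - d) ^+ m.
Proof.
move=> d0 d1; elim: m => [|m ih]; first by rewrite expr0 mul0r subr0.
have y1 : (1 - d) ^+ m <= 1 by apply: exprn_ile1; lra.
rewrite exprS -natr1; move: ((1 - d) ^+ m) ih y1 => y ih y1.
have : 0 <= d * (1 - y) by rewrite mulr_ge0// subr_ge0.
lra.
Qed.

Section norms_of_polynomials.
Variable R : realType.
Implicit Types (P : {poly R[i]}).

Lemma poly_wiener_normE (n : nat) P : (size P <= n)%N ->
  poly_wiener_norm P = (\sum_(k < n) normc P`_k)%:E.
Proof.
move=> sP; rewrite /poly_wiener_norm /wiener_norm.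
rewrite (@nneseries_split _ _ 0 n); last by move=> k _; rewrite lee_fin normc_ge0.
rewrite add0n eseries0 ?adde0; first by rewrite sumEFin big_mkord.
by move=> k nk _; rewrite nth_default ?normc0// (leq_trans sP).
Qed.

(** The supremum over the open disk is the least bound on the circle: radial continuity gives one
    direction, the maximum modulus principle the other. *)
Lemma poly_sup_normE P : exists S : R,
  [/\ poly_sup_norm P = S%:E, 0 <= S, forall z, normc z = 1 -> normc P.[z] <= S &
    forall B, (forall z, normc z = 1 -> normc P.[z] <= B) -> S <= B].
Proof.
pose A := \sum_(k < size P) normc P`_k.
have PA z : normc z <= 1 -> normc P.[z] <= A.
  move=> z1; rewrite horner_coef; apply: le_trans (normc_sum _ _ _) _.
  apply: ler_sum => k _; rewrite normcM normcX ler_piMr ?normc_ge0//.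
  by rewrite exprn_ile1 ?normc_ge0.
have up (B : R) : (forall z, normc z < 1 -> normc P.[z] <= B) ->
    (poly_sup_norm P <= B%:E)%E.
  by move=> PB; apply: ge_ereal_sup => _ [z z1 <-]; rewrite lee_fin PB.
have lo z : normc z < 1 -> ((normc P.[z])%:E <= poly_sup_norm P)%E.
  by move=> z1; apply: ereal_sup_ubound; exists z.
have ge0 : (0 <= poly_sup_norm P)%E.
  apply: le_trans (lo 0 _); first by rewrite lee_fin normc_ge0.
  by rewrite normc0.
have leA : (poly_sup_norm P <= A%:E)%E by apply: up => z /ltW /PA.
have fin : poly_sup_norm P \is a fin_num.
  by rewrite fin_numElt (lt_le_trans _ ge0)//= (le_lt_trans leA)// ltry.
exists (fine (poly_sup_norm P)); rewrite fineK//; split => //.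
- exact: fine_ge0.
- move=> z z1; set S := fine _.
  have {}lo u : normc u < 1 -> normc P.[u] <= S.
    by move=> u1; rewrite -lee_fin /S fineK// lo.
  (* the values at [t z], [t < 1], are within [C (1 - t)] of the value at [z] *)
  pose C := \sum_(k < size P) normc P`_k * k%:R.
  have C0 : 0 <= C by apply: sumr_ge0 => k _; rewrite mulr_ge0 ?normc_ge0.
  apply/ler_addgt0Pr => e e0.
  (* The [+ 1] covers [C = 0], and the minimum keeps [t >= 0]. *)
  pose d := Num.min 1 (e / (C + 1)); pose t := 1 - d.
  have d0 : 0 < d by rewrite lt_min ltr01 divr_gt0//; lra.
  have d1 : d <= 1 by rewrite ge_min lexx.
  have dC : C * d <= e.
    apply: le_trans (_ : (C + 1) * (e / (C + 1)) <= _); last first.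
      by rewrite mulrC divfK// gt_eqF//; lra.
    by apply: ler_pM => //; [exact: ltW|lra|rewrite ge_min lexx orbT].
  have tz : normc (t%:C * z) < 1.
    by rewrite normcM z1 mulr1 normc_real ger0_norm /t; lra.
  have -> : P.[z] = P.[t%:C * z] + (P.[z] - P.[t%:C * z]) by rewrite addrC subrK.
  apply: le_trans (normcD _ _) _; apply: lerD; first exact: lo.
  apply: le_trans dC; rewrite !horner_coef -sumrB mulr_suml.
  apply: le_trans (normc_sum _ _ _) _; apply: ler_sum => k _.
  rewrite exprMn -mulrBr -{1}[z ^+ k]mul1r -mulrBl !normcM normcX z1 expr1n mulr1.
  rewrite -mulrA ler_wpM2l ?normc_ge0//.
  rewrite -rmorphXn -(rmorph1 (real_complex R)) -rmorphB normc_real.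
  have b1 : 1 - k%:R * d <= t ^+ k by rewrite bernoulli_oneB// ltW.
  have b2 : t ^+ k <= 1 by apply: exprn_ile1; rewrite /t ?subr_ge0// gerBl ltW.
  by rewrite ger0_norm ?subr_ge0// lerBlDr -lerBlDl.
- move=> B PB; rewrite -lee_fin fineK//; apply: up.
  exact: maximum_modulus.
Qed.

Lemma poly_wiener_norm_le (n : nat) P : (size P <= n.+1)%N ->
  (poly_wiener_norm P <= (Num.sqrt n.+1%:R)%:E * poly_sup_norm P)%E.
Proof.
move=> sP; have [S [-> _ PS _]] := poly_sup_normE P.
rewrite (poly_wiener_normE sP) -EFinM lee_fin.
exact: sum_normc_coef_le (expi_prim_root R (ltn0Sn n)) sP PS.
Qed.

Lemma poly_besov_seminorm_le (n : nat) P : (0 < n)%N -> (size P <= n.+1)%N ->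
  (poly_besov_seminorm P <=
     (\sum_(0 <= k < n) (2 * k + 1)%:R^-1)%:E * poly_sup_norm P)%E.
Proof.
move=> n0 sP; have [S [-> S0 PS _]] := poly_sup_normE P.
rewrite -EFinM -integral_even_powers /poly_besov_seminorm /besov_seminorm.
rewrite complex_derive_horner.
have n2 : (0 < n.*2)%N by lia.
apply: ge0_le_integral_nonmeasurable => r /=; rewrite in_itv /= => /andP[r0 r1].
  apply: (le_trans (y := (normc (dilate (horner P^`()) r 0))%:E)).
    by rewrite lee_fin normc_ge0.
  have disk0 : normc (0 : R[i]) < 1 by rewrite normc0.
  by apply: ereal_sup_ubound; exists 0.
apply: ge_ereal_sup => _ [z z1 <-]; rewrite lee_fin /dilate.
apply: le_trans (normc_deriv_le _ (expi_prim_root R n2) sP PS) _.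
apply: ler_wpM2r => //; apply: ler_sum => k _.
rewrite normcM normc_real ger0_norm//.
rewrite lerXn2r ?nnegrE ?mulr_ge0 ?normc_ge0//.
by rewrite ler_piMr// ltW.
Qed.

(** The Wiener inequality bounds the nonzero leading coefficient by a multiple of [S]. *)
Lemma poly_sup_norm_gt0 P (S : R) : P != 0 -> poly_sup_norm P = S%:E -> 0 < S.
Proof.
move=> P0 PS; have sP : (size P <= (size P).-1.+1)%N by lia.
have := poly_wiener_norm_le sP; rewrite PS (poly_wiener_normE sP) -EFinM lee_fin.
have lP : 0 < normc (lead_coef P).
  by rewrite lt_neqAle normc_ge0 eq_sym normc_eq0 lead_coef_eq0 P0.
rewrite (bigD1 ord_max)//= => h.
have {}h : 0 < Num.sqrt (size P).-1.+1%:R * S.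
  apply: lt_le_trans h; apply: ltr_wpDr lP.
  by apply: sumr_ge0 => k _; exact: normc_ge0.
by move: h; rewrite pmulr_rgt0// sqrtr_gt0 ltr0n.
Qed.

Lemma best_wiener_constant_le (n : nat) :
  (best_wiener_constant R n <= (Num.sqrt n.+1%:R)%:E)%E.
Proof.
apply: ge_ereal_sup => _ [P [sP P0] <-].
have [S [PS S0 _ _]] := poly_sup_normE P.
have Sp := poly_sup_norm_gt0 P0 PS.
have := poly_wiener_norm_le sP; rewrite PS inver gt_eqF//.
by rewrite lee_pdivrMr.
Qed.

Lemma best_wiener_constant_ge (n : nat) P (B c : R) :
  (size P <= n.+1)%N -> 0 < B -> 0 < c ->
  (forall z, normc z = 1 -> normc P.[z] <= B) ->
  c * B <= \sum_(k < n.+1) normc P`_k ->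
  (c%:E <= best_wiener_constant R n)%E.
Proof.
move=> sP B0 c0 PB h.
(* A positive [c] makes the coefficient sum positive. *)
have P0 : P != 0.
  apply: contraTneq h => ->; rewrite -ltNge big1 ?mulr_gt0// => k _.
  by rewrite coef0 normc0.
have [S [PS S0 _ SB]] := poly_sup_normE P.
have Sp := poly_sup_norm_gt0 P0 PS.
apply: (le_trans (y := (poly_wiener_norm P / poly_sup_norm P)%E)); last first.
  by apply: ereal_sup_ubound; exists P.
rewrite PS inver gt_eqF// lee_pdivlMr// -EFinM (poly_wiener_normE sP) lee_fin.
by apply: le_trans h; rewrite ler_pM2l//; exact: SB.
Qed.

End norms_of_polynomials.

Theorem proposition4p1 (R : realType) :
  (forall (n : nat) (P : {poly R[i]}), (1 <= n)%N -> (size P <= n.+1)%N ->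
     (poly_wiener_norm P <= (Num.sqrt (n.+1%:R : R))%:E * poly_sup_norm P)%E /\
     (poly_besov_seminorm P <=
        (\sum_(0 <= k < n) ((2 * k + 1)%:R : R)^-1)%:E * poly_sup_norm P)%E) /\
  (best_wiener_constant R n / (Num.sqrt (n.+1%:R : R))%:E)%E
    @[n --> \oo] --> 1%E.
Proof.
split.
  move=> n P n1 sP; split; first exact: poly_wiener_norm_le.
  exact: poly_besov_seminorm_le.
have s0 n : 0 < Num.sqrt n.+1%:R :> R by rewrite sqrtr_gt0 ltr0n.
have sV n : ((Num.sqrt (n.+1%:R : R))%:E^-1 = ((Num.sqrt (n.+1%:R : R))^-1)%:E)%E.
  by rewrite inver gt_eqF.
have up n : (best_wiener_constant R n / (Num.sqrt (n.+1%:R : R))%:E <= 1)%E.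
  by rewrite sV lee_pdivrMr// mul1e; exact: best_wiener_constant_le.
have lo (e : R) : 0 < e < 1 -> \forall n \near \oo,
    ((1 - e)%:E <= best_wiener_constant R n / (Num.sqrt (n.+1%:R : R))%:E)%E.
  move=> /andP[e0 e1]; have [n0 n0P] := chirp_poly_asymptotic e0.
  exists n0 => // n /= /n0P [P [B [sP B0 PB h]]].
  rewrite sV lee_pdivlMr// -EFinM.
  by apply: best_wiener_constant_ge PB h; rewrite // mulr_gt0// subr_gt0.
have fin : \forall n \near \oo,
    (best_wiener_constant R n / (Num.sqrt (n.+1%:R : R))%:E)%E \is a fin_num.
  have h : 0 < (1 / 2 : R) < 1 by apply/andP; split; lra.
  apply: filterS (lo _ h) => n hn.
  by rewrite fin_numElt (lt_le_trans _ hn) ?ltNyr//= (le_lt_trans (up n))// ltry.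
apply/fine_cvgP; split => //; apply/cvgrPdist_le => e e0.
(* The cap keeps [1 - e'] positive, as the lower bound on the constant requires. *)
pose e' := Num.min e (1 / 2).
have e'0 : 0 < e' < 1.
  by rewrite lt_min e0 gt_min; apply/andP; split; [lra|apply/orP; right; lra].
near=> n.
have finn : (best_wiener_constant R n / (Num.sqrt (n.+1%:R : R))%:E)%E \is a fin_num.
  by near: n.
have lon : ((1 - e')%:E <= best_wiener_constant R n / (Num.sqrt (n.+1%:R : R))%:E)%E.
  by near: n; exact: lo.
have := up n; move: lon; rewrite /= -{1 2}(fineK finn) !lee_fin => l u.
rewrite ger0_norm ?subr_ge0//.
have : e' <= e by rewrite ge_min lexx.
lra.
Unshelve. all: by end_near. Qed.
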